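(* Let $R=\mathbb{C}[x,y,z]$ and let $Y=V(F)\subset\mathbb{P}^2$ be a quasihomogeneous reduced (not necessarily irreducible) curve, where $F\in R$ is a homogeneous polynomial whose Jacobian ideal $J_F=\langle F_x,F_y,F_z\rangle$ has height $2$. Then $Y$ is free if and only if there exist homogeneous polynomials $A,B,C\in R$ with $AF_x+BF_y+CF_z=0$ such that $\{A,B,C\}$ forms an $R$-regular sequence.
   Context: $F_x,F_y,F_z$ denote the partial derivatives of $F$. The curve $Y=V(F)$, with $F$ a reduced homogeneous polynomial, is called free if the $R$-module $D(Y)=\{\theta\in \mathrm{Der}_{\mathbb{C}}(R) : \theta(F)\in\langle F\rangle R\}$ is a free $R$-module. $V(J_F)\subset\mathbb{P}^2$ is the singular locus of $Y$. A polynomial (or germ) $f(u,v)=\sum c_{i,j}u^iv^j$ is weighted homogeneous if there are positive rational numbers $\alpha,\beta$ such that $f(u^\alpha,v^\beta)$ is homogeneous, i.e. $\alpha i+\beta j$ is the same for all $(i,j)$ with $c_{i,j}\neq 0$. An isolated singular point $P$ of $Y$ is a quasihomogeneous singularity if, in suitable local holomorphic coordinates $(u,v)$ centered at $P$, the germ of $Y$ at $P$ is defined by a weighted homogeneous polynomial. The curve $Y$ is quasihomogeneous if every $P\in V(J_F)$ is a quasihomogeneous singularity of $Y$. *)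

(* Defs.v *)
From HB Require Import structures.
From mathcomp Require Import all_boot all_order all_algebra.
From mathcomp Require Import boolp classical_sets functions reals complex.
From mathcomp Require Import mpoly.

Set Implicit Arguments.
Unset Strict Implicit.
Unset Printing Implicit Defensive.

Import Order.TTheory GRing.Theory Num.Theory.
Local Open Scope ring_scope.

(** ** Commutative algebra *)

Definition ideal_gen (S : comNzRingType) (s : seq S) : set S :=
  [set p | exists c : 'I_(size s) -> S, p = \sum_(i < size s) c i * s`_i].

(* Properness of the ideal generated by [s] is part of the definition. *)
Definition regular_sequence (S : comNzRingType) (s : seq S) : Prop :=
  (forall k, (k < size s)%N ->
     forall p, ideal_gen (take k s) (s`_k * p) -> ideal_gen (take k s) p)
  /\ ~ ideal_gen s 1.

Definition prime_ideal (S : comNzRingType) (P : {pred S}) : Prop :=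
  idealr_closed P /\ prime_idealr_closed P.

(* The height of the prime ideal [P] is at least [n]: some strictly increasing
   chain [c 0, ..., c n] of prime ideals ends at [P]. *)
Definition prime_height_ge (S : comNzRingType) (P : {pred S}) (n : nat) : Prop :=
  exists c : nat -> {pred S},
    [/\ forall i, (i <= n)%N -> prime_ideal (c i),
        forall i, (i < n)%N ->
          {subset c i <= c i.+1} /\ ~ {subset c i.+1 <= c i}
      & c n =i P].

(* The infimum of the heights of the prime ideals containing [I] is [h]; the
   unit ideal has no height in this sense. *)
Definition ideal_height (S : comNzRingType) (I : set S) (h : nat) : Prop :=
  (forall P : {pred S}, prime_ideal P -> (forall p, I p -> p \in P) ->
     prime_height_ge P h)
  /\ (exists P : {pred S}, [/\ prime_ideal P, forall p, I p -> p \in P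
        & ~ prime_height_ge P h.+1]).

(* The submodule [D] of [M] has a basis [B], of arbitrary cardinality. *)
Definition free_submodule (S : nzRingType) (M : lmodType S) (D : set M) : Prop :=
  exists B : set M,
    [/\ forall b, B b -> D b,
        forall t, D t -> exists n (b : 'I_n -> M) (a : 'I_n -> S),
          (forall i, B (b i)) /\ t = \sum_(i < n) a i *: b i
      & forall n (b : 'I_n -> M) (a : 'I_n -> S),
          injective b -> (forall i, B (b i)) ->
          \sum_(i < n) a i *: b i = 0 -> forall i, a i = 0].

(** ** Homogeneous polynomials in three variables *)

Definition ix : 'I_3 := @Ordinal 3 0 isT.
Definition iy : 'I_3 := @Ordinal 3 1 isT.
Definition iz : 'I_3 := @Ordinal 3 2 isT.

Definition homogeneous (K : nzRingType) (n : nat) (p : {mpoly K[n]}) : Prop :=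
  exists d : nat, p \is d.-homog.

Definition jacobian_ideal (K : fieldType) (F : {mpoly K[3]})
    : set {mpoly K[3]} :=
  ideal_gen [:: F^`M(ix); F^`M(iy); F^`M(iz)].

(* Over a field, the units of the polynomial ring are the nonzero constants. *)
Definition reduced_poly (K : fieldType) (n : nat) (F : {mpoly K[n]}) : Prop :=
  F != 0 /\ forall p q, F = p ^+ 2 * q -> p \is a GRing.unit.

(* The codomain is written [{mpoly K[n]}^o] so that derivations live in a
   (pointwise) module over the polynomial ring; linearity is over [K]. *)
Definition derivation (K : fieldType) (n : nat)
    (t : {mpoly K[n]} -> {mpoly K[n]}^o) : Prop :=
  (forall (a : K) (p q : {mpoly K[n]}),
     t (a *: p + q) = a *: (t p : {mpoly K[n]}) + t q)
  /\ (forall p q : {mpoly K[n]}, t (p * q) = t p * q + p * t q).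

Definition log_derivations (K : fieldType) (n : nat) (F : {mpoly K[n]})
    : set ({mpoly K[n]} -> {mpoly K[n]}^o) :=
  [set t | derivation t /\ ideal_gen [:: F] (t F : {mpoly K[n]})].

Definition free_curve (K : fieldType) (F : {mpoly K[3]}) : Prop :=
  free_submodule (log_derivations F).

(** ** Germs of holomorphic functions of two variables

    The local ring of germs at the origin of holomorphic functions of (u, v) is
    the ring of convergent power series: [a i j] is the coefficient of u^i v^j. *)

Definition series2 (K : Type) := nat -> nat -> K.

Section Series2.
Variable K : nzRingType.

Definition series2_one : series2 K :=
  fun i j => ((i == 0%N) && (j == 0%N))%:R.

Definition series2_mul (a b : series2 K) : series2 K :=
  fun i j => \sum_(k < i.+1) \sum_(l < j.+1) a k l * b (i - k)%N (j - l)%N.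

Definition series2_exp (a : series2 K) (n : nat) : series2 K :=
  iter n (series2_mul a) series2_one.

Definition series2_subst (n : nat) (p : {mpoly K[n]}) (s : 'I_n -> series2 K)
    : series2 K :=
  fun i j => \sum_(m <- msupp p) p@_m *
    (\big[series2_mul/series2_one]_(k < n) series2_exp (s k) (m k)) i j.

Definition series2_of_poly (g : {mpoly K[2]}) : series2 K :=
  fun i j => g@_[multinom [tuple i; j]].

End Series2.

Definition convergent (R : realType) (a : series2 R[i]) : Prop :=
  exists r M : R, 0 < r /\
    forall i j, `|a i j| * (r ^+ (i + j))%:C%C <= M%:C%C.

(** ** Quasihomogeneous singularities *)

Definition weighted_homogeneous (K : nzRingType) (g : {mpoly K[2]}) : Prop :=
  exists alpha beta w : rat, [/\ 0 < alpha, 0 < beta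
    & forall m, m \in msupp g ->
        alpha * (m ord0)%:R + beta * (m ord_max)%:R = w].

(* [p] is the vector of homogeneous coordinates of a point P. Local coordinates
   (u, v) centered at P are given by the inverse map (u, v) |-> [s(u, v)] from
   a neighbourhood of 0 to the projective plane, lifted to C^3 \ 0 with
   s(0) = p; the lifted map is a local biholomorphism onto a neighbourhood of P
   exactly when s(0), (ds/du)(0), (ds/dv)(0) are linearly independent. In these
   coordinates the germ of the curve has equation F(s(u, v)) = 0, and [g]
   defines it when F(s(u, v)) is [g] times a unit [e]. *)
Definition quasihomogeneous_at (R : realType) (F : {mpoly R[i][3]})
    (p : 'I_3 -> R[i]) : Prop :=
  exists (s : 'I_3 -> series2 R[i]) (e : series2 R[i]) (g : {mpoly R[i][2]}),
    [/\ forall k, convergent (s k) /\ s k 0%N 0%N = p k,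
        \det (\matrix_(k < 3, l < 3)
                [:: s k 0%N 0%N; s k 1%N 0%N; s k 0%N 1%N]`_l) != 0,
        convergent e /\ e 0%N 0%N != 0,
        weighted_homogeneous g
      & forall i j, series2_subst F s i j
                    = series2_mul e (series2_of_poly g) i j].

Definition singular_point (K : fieldType) (F : {mpoly K[3]})
    (p : 'I_3 -> K) : Prop :=
  (exists k, p k != 0) /\ (forall k, (F^`M(k)).@[p] = 0).

Definition quasihomogeneous_curve (R : realType) (F : {mpoly R[i][3]}) : Prop :=
  forall p : 'I_3 -> R[i], singular_point F p -> quasihomogeneous_at F p.

(* Main.v *)
Require Import Defs.
From HB Require Import structures.
From mathcomp Require Import all_boot all_order all_algebra.
From mathcomp Require Import boolp classical_sets functions reals complex.
From mathcomp Require Import mpoly ring zify.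

(** Write [f] for the gradient of [F] and call syzygy a vector [v] with
    [v . f = 0]. By Euler's formula the logarithmic derivations are the sum of
    the multiples of the Euler derivation and of the syzygies, so freeness of the
    curve is a property of the syzygies. Height two is used in the form of
    [binary_form_in_height2_ideal]: by elimination, the Jacobian ideal contains
    a nonzero form in any two of the three variables. As such a form is a product
    of linear forms, a vector parallel to [f] is a polynomial multiple of [f]
    ([parallel_multiple]), and the singular locus is finite in the projective
    plane ([finite_zero_ratios]).

    Suppose that a syzygy [w] is a regular sequence. The relations between the
    entries of a regular sequence are the Koszul ones, and [f] is such a relation,
    so [f = w x u] is a cross product. Then [u] is a syzygy too, and [w], [u] form
    a basis of the syzygies: if [v] is a syzygy, [v x w] and [v x u] are parallel
    to [f], hence multiples of it, and these multiples are the coordinates of [v]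
    ([cross_span], [regular_syzygy_free]).

    Conversely, let the curve be free. Minimal homogeneous generators of the
    syzygies form a basis [a], [u] of degrees [r <= s], and [f] is a multiple
    of [a x u] ([homogeneous_basis]). So [a] and [u] are independent at
    every point that is not singular. At a singular point they are dependent, but
    quasihomogeneity prevents them from both vanishing: a weighted homogeneous
    local equation is an eigenvector of a weighted Euler derivation, and
    comparing this derivation with the usual Euler formula gives a formal syzygy
    that does not vanish at the point ([formal_syzygy]); the point being isolated,
    a truncation of this syzygy can be corrected into a polynomial one
    ([quasihomogeneous_syzygy]). The singular points being finitely many,
    [w = u + g a] vanishes nowhere in the projective plane for a general form [g]
    of degree [s - r] ([generic_syzygy]). Then the ideal generated by the entries
    of [w] contains powers of the three variables ([power_in_ideal]; the forms
    obtained by elimination are available here since this ideal contains the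
    entries of [f]), so that the Koszul complex of [w] is exact
    ([koszul_exact]) and [w] is a regular sequence ([nozero_regular]). *)

Set Implicit Arguments.
Unset Strict Implicit.
Unset Printing Implicit Defensive.

Import Order.TTheory GRing.Theory Num.Theory.
Local Open Scope ring_scope.

(** * Homogeneous components and derivations *)

Section MpolyTools.
Variables (n : nat) (K : comNzRingType).
Implicit Types (p q : {mpoly K[n]}).

Lemma mpoly_closure_ind (P : {mpoly K[n]} -> Prop) :
  (forall c, P c%:MP) -> (forall i, P 'X_i) ->
  (forall p q, P p -> P q -> P (p + q)) ->
  (forall p q, P p -> P q -> P (p * q)) -> forall p, P p.
Proof.
move=> PC PX PD PM; elim/mpolyind => [|c m p _ _ IH]; first exact: (PC 0).
apply: (PD) => //; rewrite -mul_mpolyC; apply: (PM) => //.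
rewrite mpolyXE_id; elim/big_rec: _ => [|i x _ Px]; first exact: (PC 1).
apply: (PM) => //; elim: (m i) => [|k IHk]; first by rewrite expr0; exact: (PC 1).
by rewrite exprS; apply: PM.
Qed.

(** Both sides are derivations along [phi], so it suffices to compare them on
    the variables. With [phi] the identity this describes the derivations of the
    polynomial ring; with [phi] a substitution it is the chain rule. *)
Lemma derivation_chain (A : comNzRingType) (phi : {rmorphism {mpoly K[n]} -> A})
    (delta : {mpoly K[n]} -> A) :
  (forall p q, delta (p + q) = delta p + delta q) ->
  (forall p q, delta (p * q) = delta p * phi q + phi p * delta q) ->
  (forall c, delta c%:MP = 0) ->
  forall p, delta p = \sum_(i < n) phi p^`M(i) * delta 'X_i.
Proof.
move=> dD dM dC; elim/mpoly_closure_ind => [c|i|p q Hp Hq|p q Hp Hq].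
- by rewrite dC big1 // => i _; rewrite mderivC rmorph0 mul0r.
- rewrite (bigD1 i) //= mderivX mnmE eqxx scale1r -{2}[U_(i)%MM]add0m addmK mpolyX0 rmorph1 mul1r.
  rewrite big1 ?addr0 // => j ne_ji.
  by rewrite mderivX mnm1E eq_sym (negbTE ne_ji) scale0r rmorph0 mul0r.
- rewrite dD Hp Hq -big_split; apply: eq_bigr => i _.
  by rewrite /= mderivD rmorphD mulrDl.
- rewrite dM Hp Hq mulr_suml mulr_sumr -big_split; apply: eq_bigr => i _.
  by rewrite /= mderivM rmorphD !rmorphM /=; ring.
Qed.

Lemma euler_homog d p : p \is d.-homog ->
  \sum_(i < n) 'X_i * p^`M(i) = d%:R *: p.
Proof.
move=> /dhomogP hp.
rewrite {2}[p]mpolyE scaler_sumr.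
under eq_bigr => i _ do rewrite {1}[p]mpolyE raddf_sum mulr_sumr.
rewrite exchange_big /= !big_seq; apply: eq_bigr => m /hp <-.
rewrite /= mdegE natr_sum scaler_suml; apply: eq_bigr => i _.
rewrite mderivZ mderivX !scalerA.
case: (posnP (m i)) => [->|mi]; first by rewrite mulr0 mul0r !scale0r mulr0.
rewrite -scalerAr -mpolyXD addmC submK; first by rewrite mulrC.
by rewrite lep1mP -lt0n.
Qed.

Definition homog_part d p : {mpoly K[n]} := pihomog (mdeg (n:=n)) d p.

Lemma homog_part_is_linear d : linear (homog_part d).
Proof. exact: pihomog_is_linear. Qed.
HB.instance Definition _ d :=
  GRing.isLinear.Build K {mpoly K[n]} {mpoly K[n]} _ (homog_part d) (homog_part_is_linear d).

Lemma homog_partP d p : homog_part d p \is d.-homog.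
Proof. exact: pihomogP. Qed.

Lemma homog_part_id d p : p \is d.-homog -> homog_part d p = p.
Proof. exact: pihomog_dE. Qed.

Lemma homog_part_ne d e p : p \is d.-homog -> d != e -> homog_part e p = 0.
Proof. by move=> hp ne; apply: pihomog_ne0 hp. Qed.

Lemma homog_part_sum p : p = \sum_(d < msize p) homog_part d p.
Proof. exact: pihomog_partitionE. Qed.

Lemma homog_part_sum_le k p : (msize p <= k)%N -> \sum_(d < k) homog_part d p = p.
Proof. by move=> hk; rewrite -pihomog_partitionE. Qed.

Lemma homog_part_large d p : (msize p <= d)%N -> homog_part d p = 0.
Proof.
move=> hd; rewrite /homog_part pihomogE big_seq_cond big_pred0 // => m.
apply/negP => /andP[/msize_mdeg_lt] h /eqP e.
by move: (leq_trans h hd); rewrite e ltnn.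
Qed.

Lemma homog_partM d e f p : f \is e.-homog ->
  homog_part d (f * p) = if (e <= d)%N then f * homog_part (d - e) p else 0.
Proof.
move=> hf; rewrite {1}[p]homog_part_sum mulr_sumr raddf_sum /=.
have hm k : f * homog_part k p \is (e + k).-homog by apply: dhomogM (homog_partP _ _).
case: leqP => hed; last first.
  rewrite big1 // => k _; apply: homog_part_ne (hm k) _.
  by rewrite neq_ltn (leq_trans hed (leq_addr _ _)) orbT.
case: (ltnP (d - e) (msize p)) => hs; last first.
  rewrite homog_part_large ?mulr0 //; rewrite big1 // => k _.
  apply: homog_part_ne (hm k) _; rewrite neq_ltn; apply/orP; left.
  by rewrite -ltn_subRL (leq_trans (ltn_ord k)).
rewrite (bigD1 (Ordinal hs)) //= big1 ?addr0 => [|k ne].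
  by rewrite homog_part_id //; have := hm (d - e)%N; rewrite subnKC.
apply: homog_part_ne (hm k) _; apply: contra_neq ne => ek.
by apply: val_inj; rewrite /= -ek addKn.
Qed.

Lemma homog_part0E p : homog_part 0 p = (p.@[fun=> 0])%:MP.
Proof.
elim/mpolyind: p => [|c m p _ _ IH]; first by rewrite raddf0 meval0 mpolyC0.
rewrite linearP /= IH mevalD mevalZ mpolyCD; congr (_ + _).
rewrite /homog_part pihomogX mdeg_eq0; case: eqP => [->|/eqP m0].
  by rewrite mpolyX0 meval1 mulr1 -mul_mpolyC mulr1.
rewrite scaler0 mevalX; move: m0; rewrite -mdeg_eq0 mdegE sum_nat_eq0 negb_forall.
case/existsP => i; rewrite implyTb => mi.
by rewrite (bigD1 i) //= expr0n (negbTE mi) mul0r mulr0 mpolyC0.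
Qed.

Lemma mderiv_homog d p i : p \is d.-homog -> p^`M(i) \is d.-1.-homog.
Proof.
move=> /dhomogP hp; rewrite [p]mpolyE raddf_sum big_seq /=.
apply: rpred_sum => m /hp hm; rewrite mderivZ mderivX scalerA.
case: (posnP (m i)) => [->|mi]; first by rewrite mulr0 scale0r dhomog0.
apply: rpredZ; rewrite dhomogX /=; apply/eqP.
have := mdegD (m - U_(i)) U_(i); rewrite submK ?lep1mP -?lt0n // hm mdeg1 => ->.
by rewrite addn1.
Qed.

Lemma mmap_homog (A : comNzRingType) (phi : K -> A) d p (v : 'I_n -> A) c :
  p \is d.-homog -> mmap phi (fun i => c * v i) p = c ^+ d * mmap phi v p.
Proof.
move=> /dhomogP hp; rewrite /mmap mulr_sumr !big_seq.
apply: eq_bigr => m /hp <-; rewrite /= mdegE mulrCA; congr (_ * _).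
rewrite /mmap1 /=; under eq_bigr => i _ do rewrite exprMn.
by rewrite big_split /= prodrXr.
Qed.

Lemma meval_homog d p (v : 'I_n -> K) c : p \is d.-homog ->
  p.@[fun i => c * v i] = c ^+ d * p.@[v].
Proof. exact: mmap_homog. Qed.

End MpolyTools.

(** * Elimination in an ideal of height two *)

Section PrimeIdealTheory.
Variables (S : comNzRingType) (P : {pred S}).
Hypothesis Pprime : prime_ideal P.

Lemma prime_ideal0 : 0 \in P.
Proof. by case: Pprime => -[]. Qed.
Lemma prime_ideal1 : 1 \notin P.
Proof. by case: Pprime => -[]. Qed.
Lemma prime_idealMl a u : u \in P -> a * u \in P.
Proof.
by move=> Pu; case: Pprime => -[P0 _ PD] _; rewrite -[_ * _]addr0 PD.
Qed.
Lemma prime_idealD u v : u \in P -> v \in P -> u + v \in P.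
Proof. by move=> Pu Pv; case: Pprime => -[_ _ PD] _; rewrite -[u]mul1r PD. Qed.
Lemma prime_idealM u v : u * v \in P -> u \in P \/ v \in P.
Proof. by case: Pprime => _ PM /PM /orP. Qed.
End PrimeIdealTheory.

Section Elimination.
Variables (S : comNzRingType) (P : idomainType).
Variables (phi : {rmorphism S -> {poly P}}) (psi : {poly P} -> S).
Hypotheses (phiK : cancel phi psi) (psiK : cancel psi phi).

Lemma dvdp_prime_ideal (h : {poly P}) : h = 0 \/ irreducible_poly h ->
  prime_ideal [pred s | h %| phi s].
Proof.
move=> h0_or_irr; split.
  split; rewrite ?inE ?rmorph0 ?dvdp0 ?rmorph1 //.
    case: h0_or_irr => [->|[h_gt1 _]]; first by rewrite dvd0p oner_eq0.
    by rewrite dvdp1; case: (size h) h_gt1 => [|[]].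
  move=> a u v; rewrite !inE => hu hv; rewrite rmorphD rmorphM /=.
  by rewrite dvdp_add // dvdp_mull.
move=> u v; rewrite !inE rmorphM.
case: h0_or_irr => [->|hirr]; first by rewrite !dvd0p mulf_eq0.
case: (boolP (h %| phi u)) => //= hu.
by rewrite Gauss_dvdpr // irreducible_poly_coprime.
Qed.

(** Over the integral domain [P], divisibility of polynomials means divisibility
    over its field of fractions, so the prime ideal here is the trace on [S] of
    the ideal generated by [h] in a principal ideal domain. If [h] is zero there
    is no nonzero prime ideal below it. Otherwise let [c1] be such an ideal and
    [s] a nonzero element of [c1] of least degree. Up to a constant, [s] is a
    multiple of [h], and the cofactor has smaller degree, so [h] itself lies in
    [c1]; hence [c1] contains every multiple of [h], since nonzero constants lie
    outside the trace. *)
Lemma dvdp_prime_height (h : {poly P}) : h = 0 \/ irreducible_poly h ->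
  ~ prime_height_ge [pred s | h %| phi s] 2.
Proof.
move=> h0_or_irr [c [cprime csub c2]].
have Q s : (s \in c 2) = (h %| phi s) by rewrite c2.
have [c01 nc10] := csub 0%N isT; have [c12 nc21] := csub 1%N isT.
have pr0 := cprime 0%N isT; have pr1 := cprime 1%N isT.
have [s s1 s_neq0] : exists2 s, s \in c 1%N & s != 0.
  apply: contrapT => noS; apply: nc10 => s s1.
  have [->|s_neq0] := eqVneq s 0; first exact: prime_ideal0.
  by case: noS; exists s.
have phi_inj s' : s' != 0 -> phi s' != 0.
  by apply: contra_neq => e; rewrite -[s']phiK e -(rmorph0 phi) phiK.
case: h0_or_irr => [h0|hirr].
  by have := c12 _ s1; rewrite Q h0 dvd0p (negbTE (phi_inj _ s_neq0)).
have [h_gt1 _] := hirr.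
pose pr n := `[< exists s, [/\ s \in c 1%N, s != 0 & size (phi s) = n] >].
have : exists n, pr n by exists (size (phi s)); apply/asboolP; exists s.
case/ex_minnP => n /asboolP [{s s1 s_neq0} s [s1 s_neq0 <-]] smin.
have h1 : psi h \in c 1%N.
  have := c12 _ s1; rewrite Q => /Pdiv.Idomain.dvdpP [[a q] /= a_neq0 eaq].
  have q_neq0 : q != 0.
    apply: contra_neq (phi_inj _ s_neq0) => q0.
    have := congr1 (size \o polyseq) eaq; rewrite /= size_scale // q0 mul0r size_poly0.
    by move/eqP; rewrite size_poly_eq0 => /eqP.
  have : psi q * psi h \in c 1%N.
    have -> : psi q * psi h = psi a%:P * s.
      by apply: (can_inj phiK); rewrite !rmorphM !psiK mul_polyC.
    exact: prime_idealMl.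
  case/(prime_idealM pr1) => // q1.
  have /smin : pr (size q).
    apply/asboolP; exists (psi q); split=> //; last by rewrite psiK.
    by apply: contra_neq q_neq0 => e; rewrite -[q]psiK e rmorph0.
  rewrite -(size_scale (phi s) a_neq0) eaq size_mul ?(irredp_neq0 hirr) //.
  have : (0 < size q)%N by rewrite size_poly_gt0.
  by case: (size q) (size h) h_gt1 => [//|m] [|[|m']] // _ _;
    rewrite !addnS /= ltnNge leq_addr.
apply: nc21 => t; rewrite Q => /Pdiv.Idomain.dvdpP [[a q] /= a_neq0 eaq].
have : psi a%:P * t \in c 1%N.
  have -> : psi a%:P * t = psi q * psi h.
    by apply: (can_inj phiK); rewrite !rmorphM !psiK mul_polyC.
  exact: prime_idealMl.
case/(prime_idealM pr1) => // /c12; rewrite Q psiK => /dvdp_leq.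
rewrite polyC_eq0 size_polyC a_neq0 => /(_ isT).
by rewrite leqNgt h_gt1.
Qed.

Lemma irreducible_factor (g : {poly P}) : (1 < size g)%N ->
  exists2 h, irreducible_poly h & h %| g.
Proof.
move=> g_gt1.
pose pr n := `[< exists h : {poly P}, [/\ h %| g, (1 < size h)%N & size h = n] >].
have : exists n, pr n by exists (size g); apply/asboolP; exists g; rewrite dvdpp.
case/ex_minnP => n /asboolP [h [hg h_gt1 <-]] hmin.
exists h => //; split=> // q q_neq1 qh.
have h_neq0 : h != 0 by rewrite -size_poly_gt0 (leq_trans _ h_gt1).
rewrite -(dvdp_size_eqp qh) eqn_leq (dvdp_leq h_neq0 qh) /=.
apply: hmin; apply/asboolP; exists q; split=> //; first exact: dvdp_trans hg.
have q_neq0 : q != 0 by apply: contraNneq h_neq0 => q0; rewrite -dvd0p -q0.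
by rewrite ltn_neqAle eq_sym q_neq1 size_poly_gt0.
Qed.

(** Over the field of fractions of [P] the three polynomials have a gcd [g].
    If [g] were zero or nonconstant, an irreducible factor of it (or zero) would
    give a prime ideal of height at most one containing them; hence [g] is a
    nonzero constant, and clearing denominators in its Bezout relation gives
    [D]. *)
Lemma height2_elimination (f : 'I_3 -> S) :
  (forall Q : {pred S}, prime_ideal Q -> (forall i, f i \in Q) ->
     prime_height_ge Q 2) ->
  exists2 D : P, D != 0 & exists c : 'I_3 -> S, D%:P = phi (\sum_i c i * f i).
Proof.
move=> height2.
pose g01 := gcdp (phi (f ix)) (phi (f iy)); pose g := gcdp g01 (phi (f iz)).
have gdvd i : g %| phi (f i).
  have g01dvd : g %| g01 by apply: dvdp_gcdl.
  case: i => -[|[|[|//]]] lt_i.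
  - by rewrite (_ : Ordinal _ = ix) ?(dvdp_trans g01dvd) ?dvdp_gcdl //; apply: val_inj.
  - by rewrite (_ : Ordinal _ = iy) ?(dvdp_trans g01dvd) ?dvdp_gcdr //; apply: val_inj.
  - by rewrite (_ : Ordinal _ = iz) ?dvdp_gcdr //; apply: val_inj.
case: (ltngtP (size g) 1) => [|g_gt1|g1].
- rewrite ltnS leqn0 size_poly_eq0 => /eqP g0; exfalso.
  apply: (@dvdp_prime_height g); first by left.
  by apply: height2 => [|i]; [apply: dvdp_prime_ideal; left|rewrite inE gdvd].
- have [h hirr hg] := irreducible_factor g_gt1; exfalso.
  apply: (@dvdp_prime_height h); first by right.
  apply: height2 => [|i]; first by apply: dvdp_prime_ideal; right.
  by rewrite inE (dvdp_trans hg).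
have [[u v] /= uv] := Bezoutp (phi (f ix)) (phi (f iy)).
have [[u' v'] /= uv'] := Bezoutp g01 (phi (f iz)).
have /Pdiv.Idomain.eqpP [[a b] /= /andP[a0 b0] eab] := uv.
pose c i := if i == ix then psi (a *: (u' * u)) else
            if i == iy then psi (a *: (u' * v)) else psi (b *: v').
have ephi : phi (\sum_i c i * f i) =
    b *: (u' * g01 + v' * phi (f iz)).
  rewrite !big_ord_recl big_ord0 addr0 /c /=.
  have -> : lift ord0 (ord0 : 'I_2) = iy by apply: val_inj.
  have -> : lift ord0 (lift ord0 (ord0 : 'I_1)) = iz by apply: val_inj.
  have -> : ord0 = ix by apply: val_inj.
  rewrite /= !rmorphD !rmorphM !psiK /= scalerDr -(scalerAl b v') addrA; congr (_ + _).
  by rewrite (scalerAr b) /g01 -eab -!scalerAl -scalerDr -!mulrA -mulrDr scalerAr.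
have sz : size (phi (\sum_i c i * f i)) = 1%N.
  by rewrite ephi size_scale // (eqp_size uv').
exists (phi (\sum_i c i * f i))`_0.
  have := lead_coef_eq0 (phi (\sum_i c i * f i)).
  by rewrite lead_coefE sz /= => ->; rewrite -size_poly_eq0 sz.
by exists c; rewrite -size1_polyC // sz.
Qed.

End Elimination.

(** * Binary forms in the ideal *)

Lemma rmorph_poly_ext (A : comNzRingType) (B : comNzRingType)
    (f g : {rmorphism {poly A} -> B}) :
  (forall c, f c%:P = g c%:P) -> f 'X = g 'X -> f =1 g.
Proof.
move=> eC eX; elim/poly_ind => [|p c IH]; first by rewrite !rmorph0.
by rewrite !rmorphD !rmorphM /= IH eX eC.
Qed.

Definition lincomb (A : comNzRingType) (f : 'I_3 -> A) (g : A) :=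
  exists c : 'I_3 -> A, g = \sum_i c i * f i.

Section BinaryForms.
Variables (K : fieldType).
Local Notation R := {mpoly K[3]}.

(** The binary form in the variables [k] and [j] of degree [n] whose
    dehomogenization at the variable [k] is [q]. *)
Definition binary_form (k j : 'I_3) (n : nat) (q : {poly K}) : R :=
  \sum_(i < n.+1) q`_i *: ('X_k ^+ (n - i) * 'X_j ^+ i).

(** What the proof retains of the hypothesis that an ideal has height two. *)
Definition eliminable (f : 'I_3 -> R) := forall k j : 'I_3, k != j ->
  exists n (q : {poly K}), [/\ q != 0, (size q <= n.+1)%N & lincomb f (binary_form k j n q)].

Lemma homogXn (i : 'I_3) n : ('X_i ^+ n : R) \is n.-homog.
Proof. by rewrite mpolyXn dhomogX /= mdegMn mdeg1 mul1n. Qed.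

Definition eval1 (V : R) : {rmorphism {poly K} -> R} :=
  horner_eval V \o map_poly (@mpolyC 3 K).

Lemma eval1C V c : eval1 V c%:P = c%:MP.
Proof. by rewrite /= map_polyC /= /horner_eval hornerC. Qed.
Lemma eval1X V : eval1 V 'X = V.
Proof. by rewrite /= map_polyX /horner_eval hornerX. Qed.

(** Eliminating the variable [l] requires viewing the ring as the univariate
    polynomials in [l] over the polynomials in [j] and [k]. *)
Section Coordinates.
Variables (k j l : 'I_3).
Hypotheses (kj : k != j) (kl : k != l) (jl : j != l).

Lemma ord3_cases i : [\/ i = k, i = j | i = l].
Proof.
suff : [|| i == k, i == j | i == l].
  by case/or3P => /eqP; [constructor 1|constructor 2|constructor 3].
apply/negPn; rewrite !negb_or; apply/negP => /and3P[ik ij il].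
have /card_uniqP e : uniq [:: i; k; j; l].
  by rewrite /= !inE !negb_or ik ij il kj kl jl.
by have := max_card (mem [:: i; k; j; l]); rewrite e card_ord.
Qed.

Definition iterC : {rmorphism K -> {poly {poly {poly K}}}} := polyC \o polyC \o polyC.
Definition iterX i : {poly {poly {poly K}}} :=
  if i == l then 'X else if i == j then 'X%:P else 'X%:P%:P.
Definition to_iter : {rmorphism R -> {poly {poly {poly K}}}} :=
  mmap iterC iterX.
Definition of_iter2 : {rmorphism {poly {poly K}} -> R} :=
  horner_eval 'X_j \o map_poly (eval1 'X_k).
Definition of_iter : {rmorphism {poly {poly {poly K}}} -> R} :=
  horner_eval 'X_l \o map_poly of_iter2.

Lemma of_iter2C c : of_iter2 c%:P = eval1 'X_k c.
Proof. by rewrite /= map_polyC /= /horner_eval hornerC. Qed.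
Lemma of_iter2X : of_iter2 'X = 'X_j.
Proof. by rewrite /= map_polyX /horner_eval hornerX. Qed.
Lemma of_iterC c : of_iter c%:P = of_iter2 c.
Proof. by rewrite /= map_polyC /= /horner_eval hornerC. Qed.
Lemma of_iterX : of_iter 'X = 'X_l.
Proof. by rewrite /= map_polyX /horner_eval hornerX. Qed.

Lemma to_iterC c : to_iter c%:MP = c%:P%:P%:P.
Proof. by rewrite /= mmapC. Qed.
Lemma to_iterXU i : to_iter 'X_i = iterX i.
Proof. by rewrite /= mmapX mmap1U. Qed.

Lemma to_iterK : cancel to_iter of_iter.
Proof.
elim/mpoly_closure_ind => [c|i|p q Hp Hq|p q Hp Hq].
- by rewrite to_iterC of_iterC of_iter2C eval1C.
- rewrite to_iterXU /iterX; case: (ord3_cases i) => ->.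
  + by rewrite (negbTE kl) (negbTE kj) of_iterC of_iter2C eval1X.
  + by rewrite (negbTE jl) eqxx of_iterC of_iter2X.
  + by rewrite eqxx of_iterX.
- by rewrite !rmorphD Hp Hq.
- by rewrite !rmorphM Hp Hq.
Qed.

Lemma of_iterK : cancel of_iter to_iter.
Proof.
suff h : (to_iter \o of_iter : {rmorphism _ -> _}) =1 idfun by move=> x; exact: h.
apply: rmorph_poly_ext => [c|]; last first.
  by rewrite [LHS](congr1 to_iter of_iterX) to_iterXU /iterX eqxx.
rewrite [LHS](congr1 to_iter (of_iterC c)).
move: c; apply: (@rmorph_poly_ext _ _ (to_iter \o of_iter2) polyC) => [c|]; last first.
  rewrite [LHS](congr1 to_iter of_iter2X) to_iterXU /iterX eqxx.
  by rewrite (negbTE jl).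
rewrite [LHS](congr1 to_iter (of_iter2C c)).
move: c; apply: (@rmorph_poly_ext _ _ (to_iter \o eval1 'X_k) (polyC \o polyC)) => [c|].
  by rewrite [LHS](congr1 to_iter (eval1C 'X_k c)) to_iterC.
rewrite [LHS](congr1 to_iter (eval1X 'X_k)) to_iterXU /iterX.
by rewrite (negbTE kl) (negbTE kj).
Qed.

Lemma homog_part_of_iter2 n (D : {poly {poly K}}) :
  homog_part n (of_iter2 D) = binary_form k j n (\poly_(i < n.+1) D`_i`_(n - i)).
Proof.
have horner_sum (A : comNzRingType) (f : {rmorphism A -> R}) (p : {poly A}) m x :
    (size p <= m)%N -> (map_poly f p).[x] = \sum_(b < m) f p`_b * x ^+ b.
  move=> hm; rewrite (@horner_coef_wide _ m).
    by apply: eq_bigr => i _; rewrite coef_map.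
  exact: leq_trans (size_poly _ _) hm.
pose m := maxn (size D) n.+1.
have -> : of_iter2 D = \sum_(a < m) eval1 'X_k D`_a * 'X_j ^+ a.
  by apply: horner_sum; rewrite leq_maxl.
pose G i : R := D`_i`_(n - i) *: ('X_k ^+ (n - i) * 'X_j ^+ i).
have -> : binary_form k j n (\poly_(i < n.+1) D`_i`_(n - i)) = \sum_(i < n.+1) G i.
  by apply: eq_bigr => i _; rewrite coef_poly ltn_ord.
rewrite raddf_sum (big_ord_widen m G) ?leq_maxr //.
rewrite [RHS]big_mkcond; apply: eq_bigr => a _.
transitivity (homog_part n ('X_j ^+ a * eval1 'X_k D`_a)); first by rewrite mulrC.
rewrite (homog_partM _ _ (homogXn _ _)) ltnS; case: leqP => // an.
rewrite /G mulrC scalerAl; congr (_ * _).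
pose m' := maxn (size D`_a) (n - a).+1.
have -> : eval1 'X_k D`_a = \sum_(b < m') (D`_a`_b)%:MP * 'X_k ^+ b.
  by apply: horner_sum; rewrite leq_maxl.
have lt_m' : (n - a < m')%N by rewrite leq_maxr.
rewrite raddf_sum /= (bigD1 (Ordinal lt_m')) //= big1 => [|b].
  by rewrite addr0 mul_mpolyC linearZ /= homog_part_id ?homogXn.
rewrite -val_eqE /= => ne.
by rewrite mul_mpolyC linearZ /= (homog_part_ne (homogXn _ _) ne) scaler0.
Qed.

(** Elimination gives a nonzero polynomial of the ideal in the variables [k] and
    [j] only; the generators are homogeneous of the same degree, so its
    homogeneous components belong to the ideal as well. *)
Lemma binary_form_in_height2_ideal (f : 'I_3 -> R) e :
  (forall i, f i \is e.-homog) ->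
  (forall Q : {pred R}, prime_ideal Q -> (forall i, f i \in Q) ->
     prime_height_ge Q 2) ->
  exists n (q : {poly K}), [/\ q != 0, (size q <= n.+1)%N
     & lincomb f (binary_form k j n q)].
Proof.
move=> fhomog height2.
have [D D0 [c ec]] := height2_elimination to_iterK of_iterK height2.
have {}ec : of_iter2 D = \sum_i c i * f i by rewrite -of_iterC ec to_iterK.
have Da0 : lead_coef D != 0 by rewrite lead_coef_eq0.
pose a := (size D).-1; pose b := (size D`_a).-1.
exists (a + b)%N, (\poly_(i < (a + b).+1) D`_i`_(a + b - i)).
split; last 1 first.
- exists (fun i => if (e <= a + b)%N then homog_part (a + b - e) (c i) else 0).
  rewrite -homog_part_of_iter2 ec raddf_sum /=; apply: eq_bigr => i _.
  by rewrite mulrC (homog_partM _ _ (fhomog i)); case: ifP => _; rewrite ?mul0r // mulrC.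
- apply/eqP => /polyP /(_ a); rewrite coef0 coef_poly ltnS leq_addr addKn.
  by move/eqP; rewrite -/(lead_coef D`_a) lead_coef_eq0 -/(lead_coef D) (negbTE Da0).
- exact: size_poly.
Qed.
End Coordinates.

Lemma binary_form_eq0 (k j : 'I_3) n (q : {poly K}) : k != j -> (size q <= n.+1)%N ->
  binary_form k j n q = 0 -> q = 0.
Proof.
move=> kj sq e.
pose h (i : 'I_3) : {poly K} := if i == j then 'X else 1.
have := congr1 (mmap (@polyC K) h) e.
rewrite mmap0 raddf_sum /= => eq0; rewrite -[RHS]eq0.
apply/polyP => i; rewrite coef_sum.
under eq_bigr => a _ do
  rewrite -mul_mpolyC !rmorphM !rmorphXn /= mmapC !mmapX !mmap1U /h (negbTE kj) eqxx expr1n mul1r coefCM coefXn.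
case: (ltnP i n.+1) => [lt_i|le_i]; last first.
  rewrite nth_default ?(leq_trans sq) // big1 // => a _.
  by rewrite gtn_eqF ?mulr0 // (leq_trans (ltn_ord a)).
rewrite (bigD1 (Ordinal lt_i)) //= eqxx mulr1 big1 ?addr0 // => a ne.
by rewrite eq_sym (negbTE (ne : (val a != i))) mulr0.
Qed.

Lemma rmorph_binary_form (A : comNzRingType) (f : {rmorphism R -> A}) k j n q :
  f (binary_form k j n q) =
  \sum_(i < n.+1) f (q`_i)%:MP * (f 'X_k ^+ (n - i) * f 'X_j ^+ i).
Proof.
rewrite rmorph_sum; apply: eq_bigr => i _.
by rewrite -mul_mpolyC !rmorphM !rmorphXn.
Qed.
End BinaryForms.

(** * Vectors parallel to the gradient, and the finiteness of the singular locus *)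

Section EliminableFamily.
Variables (K : fieldType).
Local Notation R := {mpoly K[3]}.
Implicit Types (f v : 'I_3 -> R).

Definition subst1 (i : 'I_3) (y : R) : {rmorphism R -> R} :=
  mmap (@mpolyC 3 K) (fun a => if a == i then y else 'X_a).

Lemma subst1X i y a : subst1 i y 'X_a = if a == i then y else 'X_a.
Proof. by rewrite /= mmapX mmap1U. Qed.
Lemma subst1C i y c : subst1 i y c%:MP = c%:MP.
Proof. by rewrite /= mmapC. Qed.

Lemma subst1_sub i y (h : R) : exists h', h - subst1 i y h = ('X_i - y) * h'.
Proof.
elim/mpoly_closure_ind: h => [c|a|p q [p' Hp] [q' Hq]|p q [p' Hp] [q' Hq]].
- by exists 0; rewrite subst1C subrr mulr0.
- rewrite subst1X; case: eqP => [->|_]; first by exists 1; rewrite mulr1.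
  by exists 0; rewrite subrr mulr0.
- by exists (p' + q'); rewrite rmorphD mulrDr -Hp -Hq; ring.
- exists (p' * q + subst1 i y p * q').
  rewrite rmorphM mulrDr mulrA -Hp [_ * (_ * q')]mulrCA -Hq; ring.
Qed.

(** An ideal in [g]; the aim is to show that it contains 1 as soon as [v] is
    parallel to [f]. *)
Definition multiplier f v (g : R) := exists beta, forall i, g * v i = beta * f i.

Lemma binary_form_recX k j n (q : {poly K}) : (size q <= n.+1)%N ->
  binary_form k j n.+1 q = 'X_k * binary_form k j n q.
Proof.
move=> sq; rewrite /binary_form big_ord_recr /= nth_default // scale0r addr0.
rewrite mulr_sumr; apply: eq_bigr => i _.
by rewrite -scalerAr mulrA -exprS subSn // -ltnS.
Qed.

Lemma binary_formD k j n (p q : {poly K}) :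
  binary_form k j n (p + q) = binary_form k j n p + binary_form k j n q.
Proof.
by rewrite /binary_form -big_split; apply: eq_bigr => i _ /=; rewrite coefD scalerDl.
Qed.

Lemma binary_formZ k j n c (q : {poly K}) : binary_form k j n (c *: q) = c *: binary_form k j n q.
Proof.
by rewrite /binary_form scaler_sumr; apply: eq_bigr => i _; rewrite coefZ scalerA.
Qed.

Lemma binary_form_mulX k j n (q : {poly K}) : binary_form k j n.+1 (q * 'X) = 'X_j * binary_form k j n q.
Proof.
rewrite /binary_form big_ord_recl /= coefMX eqxx scale0r add0r mulr_sumr.
apply: eq_bigr => i _; rewrite coefMX /= /bump /= add1n subSS.
by rewrite -scalerAr exprS; congr (_ *: _); rewrite mulrCA.
Qed.

Lemma binary_form_rec k j n r (q : {poly K}) : (size q <= n.+1)%N ->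
  binary_form k j n.+1 (q * ('X - r%:P)) = ('X_j - r *: 'X_k) * binary_form k j n q.
Proof.
move=> sq; have -> : q * ('X - r%:P) = q * 'X + (- r) *: q.
  by rewrite mulrBr [q * r%:P]mulrC mul_polyC scaleNr.
by rewrite binary_formD binary_form_mulX binary_formZ binary_form_recX // scaleNr mulrBl -scalerAl.
Qed.

Variables (f : 'I_3 -> R).
Hypothesis felim : eliminable f.

Lemma lincomb_multiplier v g : (forall i j, v i * f j = v j * f i) ->
  lincomb f g -> multiplier f v g.
Proof.
move=> vf [c ->]; exists (\sum_j c j * v j) => i.
by rewrite !mulr_suml; apply: eq_bigr => j _; rewrite -!mulrA (vf j) [v i * _]mulrC.
Qed.

(** A linear form is prime, being the generator of the kernel of a substitution
    [rho] into an integral domain, so it suffices that it does not divide all the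
    entries of [f]. Otherwise [rho] would kill the whole ideal, including the
    nonzero form in the variables [a] and [b], on which [rho] acts trivially. *)
Lemma cancel_linear v (i a b : 'I_3) r g : a != b -> i != a -> i != b ->
  multiplier f v (('X_i - r *: 'X_a) * g) -> multiplier f v g.
Proof.
move=> ab ia ib [beta Hbeta].
pose l : R := 'X_i - r *: 'X_a; pose rho := subst1 i (r *: 'X_a).
have rhoX c : c != i -> rho 'X_c = 'X_c by move=> ci; rewrite subst1X (negbTE ci).
have rhol : rho l = 0.
  rewrite rmorphB subst1X eqxx -mul_mpolyC rmorphM subst1C rhoX ?subrr //.
  by rewrite eq_sym.
have l0 : l != 0.
  apply/eqP => /(congr1 (mcoeff U_(i))).
  rewrite raddfB /= mcoeffZ !mcoeffX eqxx eq_mnm1 eq_sym (negbTE ia) mulr0 subr0.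
  by rewrite mcoeff0 => /eqP; rewrite oner_eq0.
have [t rho_ft] : exists t, rho (f t) != 0.
  apply: contrapT => /forallNP H.
  have [n [q [q0 sq [c ec]]]] := felim ab.
  have : rho (binary_form a b n q) = binary_form a b n q.
    rewrite rmorph_binary_form /binary_form; apply: eq_bigr => e _.
    by rewrite subst1C !rhoX ?mul_mpolyC // eq_sym.
  rewrite ec rmorph_sum big1 -?ec => [/esym e0|e _].
    by rewrite (binary_form_eq0 ab sq e0) eqxx in q0.
  by have /negP := H e; rewrite negbK rmorphM => /eqP ->; rewrite mulr0.
have beta0 : rho beta = 0.
  have /eqP := congr1 rho (Hbeta t).
  by rewrite !rmorphM /= -/rho rhol !mul0r eq_sym mulf_eq0 (negbTE rho_ft) orbF => /eqP.
have [beta' ebeta] := subst1_sub i (r *: 'X_a) beta.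
exists beta' => j; apply: (mulfI l0).
by rewrite !mulrA Hbeta -ebeta [subst1 _ _ _]beta0 subr0.
Qed.

End EliminableFamily.

Section ClosedField.
Variables (K : closedFieldType).
Local Notation R := {mpoly K[3]}.
Variables (f : 'I_3 -> R).
Hypothesis felim : eliminable f.

(** Over an algebraically closed field a binary form is a product of linear
    forms, which are cancelled one by one. *)
Lemma multiplier_binary_form (v : 'I_3 -> R) n (q : {poly K}) : q != 0 -> (size q <= n.+1)%N ->
  multiplier f v (binary_form ix iy n q) -> multiplier f v 1.
Proof.
elim: n q => [|n IH] q q0 sq.
  (* a form of degree zero *)
  have [c c0 ->] : exists2 c, c != 0 & q = c%:P.
    exists q`_0; last exact: size1_polyC.
    by apply: contra_neq q0 => e; rewrite (size1_polyC sq) e polyC0.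
  rewrite /binary_form big_ord_recl big_ord0 !expr0 mulr1 addr0 coefC /=.
  move=> [beta Hb]; exists (c^-1 *: beta) => i.
  by rewrite -scalerAl -Hb -scalerAl scalerA mulVf // scale1r.
(* either the first variable divides the form, or its dehomogenization has a root [r] *)
case: (ltngtP (size q) n.+2) sq => // [sq _|sq _].
  rewrite binary_form_recX // -[X in X * _]subr0 -(scale0r 'X_iy).
  by move=> /cancel_linear => /(_ felim iz isT isT isT); apply: IH.
have /closed_rootP [r /factor_theorem [q' eq']] : size q != 1%N by rewrite sq.
have q'0 : q' != 0 by apply: contra_neq q0; rewrite eq' => ->; rewrite mul0r.
have sq' : (size q' <= n.+1)%N.
  by move: sq; rewrite eq' size_Mmonic ?monicXsubC // size_XsubC addn2 /= => -[->].
rewrite eq' binary_form_rec // => /cancel_linear => /(_ felim iz isT isT isT).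
exact: IH.
Qed.

(** The ideal generated by [f] has depth at least two: the ideal of multipliers
    contains it, hence contains a product of linear forms, each of which can be
    cancelled. *)
Lemma parallel_multiple (v : 'I_3 -> R) : (forall i j, v i * f j = v j * f i) ->
  exists beta, forall i, v i = beta * f i.
Proof.
move=> vf; have [n [q [q0 sq lc]]] := felim (isT : ix != iy).
have [beta Hb] := multiplier_binary_form q0 sq (lincomb_multiplier vf lc).
by exists beta => i; rewrite -Hb mul1r.
Qed.

Lemma meval_binary_form k j n (q : {poly K}) (p : 'I_3 -> K) : p k != 0 ->
  (size q <= n.+1)%N ->
  (binary_form k j n q).@[p] = p k ^+ n * q.[p j / p k].
Proof.
move=> pk sq; rewrite rmorph_binary_form (horner_coef_wide _ sq) mulr_sumr.
apply: eq_bigr => i _; rewrite /= mevalC !mevalXU exprMn exprVn.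
have lei : (i <= n)%N by rewrite -ltnS.
have -> : p k ^+ n = p k ^+ (n - i) * p k ^+ i by rewrite -exprD subnK.
by field; rewrite expf_neq0.
Qed.

(** The ratio of two coordinates of a common zero is a root of a fixed nonzero
    polynomial, so there are finitely many common zeros in the projective plane. *)
Lemma finite_zero_ratios : exists L : seq K, forall p : 'I_3 -> K,
  (forall i, (f i).@[p] = 0) -> forall k j, p k != 0 -> p j / p k \in L.
Proof.
have H k j : exists Lkj : seq K, forall p : 'I_3 -> K,
    (forall i, (f i).@[p] = 0) -> p k != 0 -> p j / p k \in Lkj.
  have [<-|kj] := eqVneq k j.
    by exists [:: 1] => p _ pk; rewrite divff // inE.
  have [n [q [q0 sq [c ec]]]] := felim kj.
  have [rs ers] := closed_field_poly_normal q.
  exists rs => p fp pk.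
  have : (binary_form k j n q).@[p] = 0.
    by rewrite ec rmorph_sum big1 // => i _; rewrite rmorphM /= fp mulr0.
  rewrite meval_binary_form // => /eqP; rewrite mulf_eq0 expf_eq0 (negbTE pk) andbF /=.
  rewrite {1}ers hornerZ mulf_eq0 lead_coef_eq0 (negbTE q0) /=.
  by rewrite -/(root _ _) root_prod_XsubC.
have {}H k := choice (H k); pose L k := projT1 (H k).
exists (flatten [seq L k j | k <- enum 'I_3, j <- enum 'I_3]) => p fp k j pk.
apply/flattenP; exists (L k j); last exact: (projT2 (H k)).
by apply/allpairsP; exists (k, j); rewrite !mem_enum.
Qed.

End ClosedField.

(** * Cross products and exactness of the Koszul complex *)

Lemma ord3_ind (P : 'I_3 -> Prop) : P ix -> P iy -> P iz -> forall i, P i.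
Proof.
move=> Px Py Pz i; have [->|->|->] // := @ord3_cases ix iy iz isT isT isT i.
Qed.

Lemma ord3_third (k j : 'I_3) : k != j -> exists l, k != l /\ j != l.
Proof.
elim/ord3_ind: k; elim/ord3_ind: j => // _;
  by [exists ix|exists iy|exists iz].
Qed.

Lemma sum3 (A : nmodType) (f : 'I_3 -> A) : \sum_i f i = f ix + f iy + f iz.
Proof.
rewrite !big_ord_recl big_ord0 addr0 addrA.
by congr (f _ + f _ + f _); apply: val_inj.
Qed.

Section VectorProducts.
Variable A : comPzRingType.
Implicit Types (a b c : 'I_3 -> A).

Definition dot a b := \sum_i a i * b i.
Definition cross a b (i : 'I_3) : A :=
  if i == ix then a iy * b iz - a iz * b iy
  else if i == iy then a iz * b ix - a ix * b iz
  else a ix * b iy - a iy * b ix.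

Lemma dotE a b : dot a b = a ix * b ix + a iy * b iy + a iz * b iz.
Proof. exact: sum3. Qed.

Lemma dotC a b : dot a b = dot b a.
Proof. by apply: eq_bigr => i _; rewrite mulrC. Qed.

Lemma cross_cross a b c i : cross a (cross b c) i = b i * dot a c - c i * dot a b.
Proof. by rewrite !dotE; elim/ord3_ind: i; rewrite /cross /=; ring. Qed.

Lemma dot_cross_left a b : dot a (cross a b) = 0.
Proof. by rewrite dotE /cross /=; ring. Qed.

Lemma dot_cross_right a b : dot b (cross a b) = 0.
Proof. by rewrite dotE /cross /=; ring. Qed.

Lemma crossvv a i : cross a a i = 0.
Proof. by elim/ord3_ind: i; rewrite /cross /=; ring. Qed.

Lemma crossC a b i : cross a b i = - cross b a i.
Proof. by elim/ord3_ind: i; rewrite /cross /=; ring. Qed.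

Lemma cross_combl p q r a b c e i :
  cross (fun i => p * a i + q * b i + r * c i) e i =
  p * cross a e i + q * cross b e i + r * cross c e i.
Proof. by elim/ord3_ind: i; rewrite /cross /=; ring. Qed.

Lemma cross0_parallel a b : (forall i, cross a b i = 0) ->
  forall i j, b i * a j = b j * a i.
Proof.
move=> e; have /eqP := e ix; have /eqP := e iy; have /eqP := e iz.
rewrite /cross /= !subr_eq0 => /eqP e3 /eqP e2 /eqP e1.
by elim/ord3_ind; elim/ord3_ind; rewrite // mulrC 1?[RHS]mulrC.
Qed.

Lemma mul_cross a b c i k : a i * cross b c k =
  b i * cross a c k - c i * cross a b k + (i == k)%:R * dot (cross a b) c.
Proof.
by rewrite dotE; elim/ord3_ind: i; elim/ord3_ind: k; rewrite /cross /=; ring.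
Qed.
End VectorProducts.

Section MonomialRegularity.
Variables (K : fieldType).
Local Notation R := {mpoly K[3]}.

Lemma mcoeffXnM (a : 'I_3) N (p : R) (m : 'X_{1..3}) : (m a < N)%N -> ('X_a ^+ N * p)@_m = 0.
Proof.
move=> ma; apply: memN_msupp_eq0; rewrite mulrC mpolyXn.
rewrite (perm_mem (msuppMX _ _)); apply/mapP => -[m' _ e].
by move: ma; rewrite e mnmDE mulmnE mnm1E eqxx mul1n ltnNge leq_addr.
Qed.

Lemma monomial_ideal (a b : 'I_3) N (h : R) :
  (forall m, h@_m != 0 -> (N <= m a)%N || (N <= m b)%N) ->
  exists p q, h = 'X_a ^+ N * p + 'X_b ^+ N * q.
Proof.
move=> H; pose I (g : R) := exists p q, g = 'X_a ^+ N * p + 'X_b ^+ N * q.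
have mono (m : 'X_{1..3}) (c : 'I_3) : (N <= m c)%N ->
    'X_c ^+ N * 'X_[m - U_(c) *+ N] = 'X_[m] :> R.
  move=> mc; rewrite mpolyXn -mpolyXD addmC submK //.
  apply/mnm_lepP => i; rewrite mulmnE mnm1E; case: eqP => [<-|_]; by rewrite ?mul1n.
rewrite -/(I h) [h]mpolyE big_seq; apply: big_ind => [|_ _ [p [q ->]] [p' [q' ->]]|m].
- by exists 0, 0; rewrite !mulr0 addr0.
- by exists (p + p'), (q + q'); ring.
- rewrite mcoeff_msupp => /H /orP[] /mono e.
    by exists (h@_m *: 'X_[m - U_(a) *+ N]), 0; rewrite mulr0 addr0 -scalerAr e.
  by exists 0, (h@_m *: 'X_[m - U_(b) *+ N]); rewrite mulr0 add0r -scalerAr e.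
Qed.

(** Membership in a monomial ideal is read off the monomials, and multiplying by a
    power of the variable [c] does not change their exponents in [a] and [b]. *)
Lemma monomial_regular (a b c : 'I_3) N (h p q : R) : c != a -> c != b ->
  'X_c ^+ N * h = 'X_a ^+ N * p + 'X_b ^+ N * q ->
  exists p' q', h = 'X_a ^+ N * p' + 'X_b ^+ N * q'.
Proof.
move=> ca cb e; apply: monomial_ideal => m hm; apply: contraNT hm.
rewrite negb_or -!ltnNge => /andP[ma mb].
have := congr1 (mcoeff (U_(c) *+ N + m)) e.
have lt i : c != i -> (m i < N)%N -> ((U_(c) *+ N + m)%MM i < N)%N.
  by move=> ci mi; rewrite mnmDE mulmnE mnm1E (negbTE ci).
rewrite mcoeffD (mcoeffXnM _ (lt a ca ma)) (mcoeffXnM _ (lt b cb mb)).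
by rewrite mulrC mpolyXn mcoeffMX addr0 => ->.
Qed.

Lemma monomial_cancel (a c : 'I_3) N (h p : R) : c != a ->
  'X_c ^+ N * h = 'X_a ^+ N * p -> exists p', h = 'X_a ^+ N * p'.
Proof.
move=> ca e; have [|p' [q' ->]] := @monomial_regular a a c N h p 0 ca ca.
  by rewrite e mulr0 addr0.
by exists (p' + q'); rewrite mulrDr.
Qed.

(** Write [X], [Y], [Z] for the powers of the variables. As [X] is the product of
    [w] with a vector [xi], the triple product formula gives [X sigma = w x tau]
    with [tau = sigma x xi]. It remains to change [tau] by a multiple of [w], which
    does not affect [w x tau], so that it becomes divisible by [X]. The same
    formula for [Y] shows that [Y tau] is congruent to [lam w] modulo [X]; the one
    for [Z] shows that [Z lam] lies in the ideal of [X] and [Y], hence so does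
    [lam]. If [lam] is congruent to [mu Y] modulo [X], then [Y (tau - mu w)] is
    divisible by [X], hence so is [tau - mu w]. *)
Lemma koszul_exact (w : 'I_3 -> R) N (xi : 'I_3 -> 'I_3 -> R) (sigma : 'I_3 -> R) :
  (forall i, dot (xi i) w = 'X_i ^+ N) -> dot sigma w = 0 ->
  exists tau, forall i, sigma i = cross w tau i.
Proof.
move=> Hxi sw.
pose lam := dot sigma (cross (xi ix) (xi iy)).
pose tauX := cross sigma (xi ix); pose tauY := cross sigma (xi iy).
have swap i : 'X_iy ^+ N * tauX i = 'X_ix ^+ N * tauY i + lam * w i.
  have := cross_cross sigma w (cross (xi ix) (xi iy)) i.
  rewrite sw mulr0 subr0 mulrC -/lam => <-.
  have -> : cross w (cross (xi ix) (xi iy)) =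
      fun j => xi ix j * 'X_iy ^+ N - xi iy j * 'X_ix ^+ N.
    by apply: funext => j; rewrite cross_cross !(dotC w) !Hxi.
  by rewrite /tauX /tauY; elim/ord3_ind: i; rewrite /cross /=; ring.
have [mu [nu elam]] : exists mu nu, lam = 'X_ix ^+ N * nu + 'X_iy ^+ N * mu.
  pose kap := cross (xi iy) (xi iz).
  have e : 'X_iz ^+ N * lam = 'X_ix ^+ N * (- dot sigma kap) +
       'X_iy ^+ N * dot sigma (cross (xi ix) (xi iz)).
    apply/eqP; rewrite -subr_eq; apply/eqP.
    transitivity (dot sigma (cross (xi ix) (cross w kap))).
      have -> : cross w kap = fun j => xi iy j * 'X_iz ^+ N - xi iz j * 'X_iy ^+ N.
        by apply: funext => j; rewrite cross_cross !(dotC w) !Hxi.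
      by rewrite /lam !dotE /cross /=; ring.
    rewrite dotE !cross_cross Hxi.
    transitivity (dot sigma w * dot (xi ix) kap - 'X_ix ^+ N * dot sigma kap).
      by rewrite (dotE sigma w) (dotE sigma kap); ring.
    by rewrite sw mul0r add0r mulrN.
  have [p [q ->]] := monomial_regular (isT : iz != ix) (isT : iz != iy) e.
  by exists q, p.
have div i : exists t, tauX i - mu * w i = 'X_ix ^+ N * t.
  apply: (@monomial_cancel ix iy N _ (tauY i + nu * w i)) => //.
  by rewrite mulrBr swap elam; ring.
have [tau Htau] : exists tau, forall i, tauX i - mu * w i = 'X_ix ^+ N * tau i.
  by exists (projT1 (choice div)) => i; apply: (projT2 (choice div)).
exists tau => i.
have X0 : ('X_ix ^+ N : R) != 0.
  by apply/eqP => /(congr1 (mcoeff (U_(ix) *+ N))) /eqP; rewrite mpolyXn mcoeffX eqxx mcoeff0 oner_eq0.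
apply: (mulfI X0).
have tauXE j : tauX j = mu * w j + 'X_ix ^+ N * tau j by rewrite -Htau; ring.
transitivity (cross w tauX i).
  by rewrite cross_cross (dotC w sigma) sw mulr0 subr0 dotC Hxi mulrC.
by elim/ord3_ind: i; rewrite /cross /= !tauXE; ring.
Qed.

End MonomialRegularity.

(** * From an empty projective zero locus to a regular sequence *)

Section IdealGen.
Variable S : comNzRingType.
Implicit Types (a b c p : S).

Lemma ideal_gen0P p : ideal_gen [::] p <-> p = 0.
Proof.
split=> [[c ->]|->]; first by rewrite big_ord0.
by exists (fun=> 0); rewrite big_ord0.
Qed.

Lemma ideal_gen1P a p : ideal_gen [:: a] p <-> exists x, p = x * a.
Proof.
split=> [[c ->]|[x ->]]; first by exists (c ord0); rewrite big_ord1.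
by exists (fun=> x); rewrite big_ord1.
Qed.

Lemma ideal_gen2P a b p : ideal_gen [:: a; b] p <-> exists x y, p = x * a + y * b.
Proof.
split=> [[c ->]|[x [y ->]]].
  by exists (c ord0), (c (lift ord0 ord0)); rewrite !big_ord_recl big_ord0 addr0.
exists (fun i => if val i == 0%N then x else y).
by rewrite !big_ord_recl big_ord0 addr0.
Qed.

Lemma ideal_gen3P (f : 'I_3 -> S) p :
  ideal_gen [:: f ix; f iy; f iz] p <-> exists c : 'I_3 -> S, p = \sum_i c i * f i.
Proof.
have E (c : 'I_3 -> S) : \sum_(i < 3) c i * [:: f ix; f iy; f iz]`_i = \sum_i c i * f i.
  by rewrite !sum3.
by split=> [[c ->]|[c ->]]; exists c; rewrite E.
Qed.

Lemma regular_sequence3P (f : 'I_3 -> S) :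
  regular_sequence [:: f ix; f iy; f iz] <->
  [/\ forall p, f ix * p = 0 -> p = 0,
      forall p, (exists x, f iy * p = x * f ix) -> exists x, p = x * f ix,
      forall p, (exists x y, f iz * p = x * f ix + y * f iy) ->
         exists x y, p = x * f ix + y * f iy
    & ~ exists c : 'I_3 -> S, 1 = \sum_i c i * f i].
Proof.
split=> [[reg proper]|[r0 r1 r2 proper]]; split.
- move=> p e; apply/(ideal_gen0P p); apply: (reg 0%N) => //.
  by apply/ideal_gen0P.
- move=> p /ideal_gen1P e; apply/ideal_gen1P; exact: (reg 1%N).
- move=> p /ideal_gen2P e; apply/ideal_gen2P; exact: (reg 2%N).
- by move=> /ideal_gen3P.
- move=> [|[|[|//]]] _ p /=.
  + by move=> /ideal_gen0P /r0 ->; apply/ideal_gen0P.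
  + by move=> /ideal_gen1P /r1 ?; apply/ideal_gen1P.
  + by move=> /ideal_gen2P /r2 ?; apply/ideal_gen2P.
- by move=> /ideal_gen3P.
Qed.
End IdealGen.

Section MaximalIdeal.
Variables (K : fieldType).
Local Notation R := {mpoly K[3]}.

Lemma sub_meval (p : 'I_3 -> K) (g : R) :
  exists h : 'I_3 -> R, g - (g.@[p])%:MP = \sum_i h i * ('X_i - (p i)%:MP).
Proof.
elim/mpoly_closure_ind: g => [c|a|f g [f' Hf] [g' Hg]|f g [f' Hf] [g' Hg]].
- by exists (fun=> 0); rewrite mevalC subrr big1 // => i _; rewrite mul0r.
- exists (fun i => (i == a)%:R); rewrite mevalXU (bigD1 a) //= eqxx mul1r.
  by rewrite big1 ?addr0 // => i /negbTE ->; rewrite mul0r.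
- exists (fun i => f' i + g' i).
  under eq_bigr => i _ do rewrite mulrDl.
  by rewrite big_split /= -Hf -Hg mevalD mpolyCD; ring.
- exists (fun i => f' i * g + (f.@[p])%:MP * g' i).
  under eq_bigr => i _ do rewrite mulrDl mulrAC -[_ * g' i * _]mulrA.
  by rewrite big_split /= -mulr_suml -mulr_sumr -Hf -Hg mevalM mpolyCM; ring.
Qed.
End MaximalIdeal.

Section GradedIdeals.
Variables (K : fieldType).
Local Notation R := {mpoly K[3]}.
Variables (w : 'I_3 -> R) (s : nat).
Hypothesis whomog : forall i, w i \is s.-homog.

Lemma homog_part_sumM (c : 'I_3 -> R) n : homog_part n (\sum_i c i * w i) =
  \sum_i (if (s <= n)%N then homog_part (n - s) (c i) else 0) * w i.
Proof.
rewrite raddf_sum /=; apply: eq_bigr => i _.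
by rewrite mulrC (homog_partM _ _ (whomog i)); case: ifP; rewrite ?mul0r // mulrC.
Qed.

Lemma lincomb_homog_part g n : lincomb w g -> lincomb w (homog_part n g).
Proof. by move=> [c ->]; rewrite homog_part_sumM; eexists. Qed.

Lemma lincombD g h : lincomb w g -> lincomb w h -> lincomb w (g + h).
Proof.
move=> [c ->] [d ->]; exists (fun i => c i + d i).
by rewrite -big_split; apply: eq_bigr => i _; rewrite mulrDl.
Qed.

Lemma lincombMl a g : lincomb w g -> lincomb w (a * g).
Proof.
move=> [c ->]; exists (fun i => a * c i).
by rewrite mulr_sumr; apply: eq_bigr => i _; rewrite mulrA.
Qed.

Lemma graded_proper : (0 < s)%N -> ~ lincomb w 1.
Proof.
move=> s_gt0 [c e].
have := congr1 (homog_part 0) e; rewrite homog_part_sumM homog_part_id ?dhomog1 // leqNgt s_gt0 /=.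
by rewrite big1 => [/eqP|i _]; rewrite ?mul0r // oner_eq0.
Qed.

(** Exactness of the Koszul complex gives regularity of the last entry at once:
    a relation is [w x tau], and its last entry lies in the ideal of the first
    two. For the second entry, if [w_y p] is a multiple of [w_x] then the relation
    [(- x, p, 0)] yields [p = w_z t - w_x t'] where [w_y t] is again a multiple of
    [w_x]; in homogeneous components [t] has smaller degree than [p], so the
    argument can be iterated. *)
Lemma koszul_regular N : (0 < s)%N ->
  (forall i, lincomb w ('X_i ^+ N)) -> regular_sequence [:: w ix; w iy; w iz].
Proof.
move=> s_gt0 wX.
have Hx i : exists xi : 'I_3 -> R, dot xi w = 'X_i ^+ N.
  by have [c ->] := wX i; exists c.
have exact (sigma : 'I_3 -> R) : dot sigma w = 0 -> exists tau, forall i, sigma i = cross w tau i.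
  exact: (koszul_exact (projT2 (choice Hx))).
have proper := graded_proper s_gt0.
have colon n p : p \is n.-homog -> (exists x, w iy * p = x * w ix) ->
    exists x, p = x * w ix.
  elim/ltn_ind: n p => n IH p hp [x ex].
  pose sigma i := if i == ix then - x else if i == iy then p else 0.
  have [|tau Htau] := exact sigma.
    by rewrite dotE /sigma /= mulNr -ex; ring.
  have := Htau iz; rewrite /sigma /cross /= => /esym/eqP.
  rewrite subr_eq0 => /eqP etau.
  have := Htau iy; rewrite /sigma /cross /= => ep.
  have {ep} := congr1 (homog_part n) ep; rewrite homog_part_id // raddfB /=.
  rewrite !(homog_partM _ _ (whomog _)); case: leqP => sn; last first.
    by rewrite subr0 => ->; exists 0; rewrite mul0r.
  have [||y ->] := IH (n - s)%N _ (homog_part (n - s) (tau ix)) (homog_partP _ _).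
  - by rewrite ltn_subrL s_gt0 (leq_trans s_gt0).
  - exists (homog_part (n - s) (tau iy)).
    have := congr1 (homog_part n) etau.
    by rewrite !(homog_partM _ _ (whomog _)) sn => <-; rewrite mulrC.
  by move=> ->; exists (w iz * y - homog_part (n - s) (tau iz)); ring.
apply/regular_sequence3P; split => //.
- move=> p ep; pose sigma i := if i == ix then p else 0.
  have [|tau Htau] := exact sigma; first by rewrite dotE /sigma /= [p * _]mulrC ep; ring.
  have wx0 : w ix != 0.
    apply/eqP => wx0; pose e1 (i : 'I_3) : R := if i == ix then 1 else 0.
    have [|t Ht] := exact e1; first by rewrite dotE /e1 /= wx0; ring.
    apply: proper; exists (fun i => if i == iy then t iz else if i == iz then - t iy else 0).
    by rewrite sum3 /= (Ht ix : 1 = _) /cross /=; ring.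
  by apply/eqP; move/eqP: ep; rewrite mulf_eq0 (negbTE wx0).
- move=> p [x ex].
  have H n : exists y, homog_part n p = y * w ix.
    apply: (colon n) (homog_partP _ _) _; exists (homog_part n x).
    have := congr1 (homog_part (s + n)) ex.
    by rewrite [x * _]mulrC !(homog_partM _ _ (whomog _)) leq_addr addKn => ->; rewrite mulrC.
  exists (\sum_(i < msize p) projT1 (cid (H i))).
  rewrite {1}[p]homog_part_sum mulr_suml; apply: eq_bigr => i _.
  exact: (projT2 (cid (H i))).
- move=> p [x [y ep]].
  pose sigma i := if i == ix then - x else if i == iy then - y else p.
  have [|tau Htau] := exact sigma.
    by rewrite dotE /sigma /= [p * _]mulrC ep; ring.
  exists (tau iy), (- tau ix).
  by rewrite (Htau iz : p = _) /cross /=; ring.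
Qed.
End GradedIdeals.

Section Nullstellensatz.
Variables (K : closedFieldType).
Local Notation R := {mpoly K[3]}.

Definition ideal_closed (I : R -> Prop) :=
  (forall g h, I g -> I h -> I (g + h)) /\ (forall a g, I g -> I (a * g)).

Definition ideal_add (I : R -> Prop) (x g : R) := exists a b, I a /\ g = a + x * b.

Lemma ideal_addP I x : ideal_closed I -> ideal_closed (ideal_add I x).
Proof.
move=> [ID IM]; split=> [_ _ [a [b [Ia ->]]] [a' [b' [Ia' ->]]]|c _ [a [b [Ia ->]]]].
  by exists (a + a'), (b + b'); split; [exact: ID|ring].
by exists (c * a), (c * b); split; [exact: IM|ring].
Qed.

Lemma ideal_add_sub (I : R -> Prop) x g : I g -> ideal_add I x g.
Proof. by move=> Ig; exists g, 0; rewrite mulr0 addr0. Qed.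

(** If every [X_j - c] generated the unit ideal together with [I], then each
    linear factor of [q] could be cancelled modulo [I], so that [I] would contain
    1. *)
Lemma ideal_add_root (I : R -> Prop) (j : 'I_3) (q : {poly K}) :
  ideal_closed I -> ~ I 1 -> q != 0 -> I (eval1 'X_j q) ->
  exists c, ~ ideal_add I ('X_j - c%:MP) 1.
Proof.
move=> [ID IM] I1 q0 Iq; apply: contrapT => /forallNP all_improper; apply: I1.
have [rs eq] := closed_field_poly_normal q.
have {Iq} : I (\prod_(z <- rs) ('X_j - z%:MP)).
  have -> : \prod_(z <- rs) ('X_j - z%:MP) = (lead_coef q)^-1%:MP * eval1 'X_j q.
    rewrite {2}eq -mul_polyC rmorphM eval1C mulrA -mpolyCM mulVf ?lead_coef_eq0 //.
    rewrite mpolyC1 mul1r rmorph_prod; apply: eq_bigr => z _.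
    by rewrite rmorphB eval1X eval1C.
  exact: IM.
suff H g : I (\prod_(z <- rs) ('X_j - z%:MP) * g) -> I g.
  by move=> Ip; apply: H; rewrite mulr1.
elim: rs {eq} g => [|r rs IHrs] g; first by rewrite big_nil mul1r.
rewrite big_cons -mulrA => Ih; apply: IHrs; set h := _ * g in Ih *.
have := all_improper r; rewrite notK => -[a [b [Ia e]]].
rewrite -[h]mul1r e mulrDl; apply: ID; first by rewrite mulrC; apply: IM.
by rewrite mulrAC; rewrite mulrC; apply: IM.
Qed.

Variables (w : 'I_3 -> R) (s : nat).
Hypothesis whomog : forall i, w i \is s.-homog.
Hypothesis welim : eliminable w.
Hypothesis wnozero : forall p : 'I_3 -> K, (exists k, p k != 0) ->
  exists i, (w i).@[p] != 0.

(** A case of the Nullstellensatz, obtained by specializing one variable at a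
    time. If 1 were not in the ideal generated by [w] and [X_k - 1], then, since
    this ideal contains a nonzero polynomial in each of the other variables, these
    could be specialized successively without reaching the unit ideal, and the
    resulting point would be a common zero of [w]. Hence 1 is in that ideal, and
    comparing homogeneous components turns the setting [X_k = 1] back into a power
    of [X_k]. *)
Lemma power_in_ideal k : exists N, lincomb w ('X_k ^+ N).
Proof.
have Iw : ideal_closed (lincomb w).
  by split=> *; [apply: lincombD|apply: lincombMl].
pose I := ideal_add (lincomb w) ('X_k - 1).
have : I 1.
  apply: contrapT => I1.
  have [j kj] : exists j, k != j.
    by elim/ord3_ind: (k); [exists iy|exists ix|exists ix].
  have [l [kl jl]] := ord3_third kj.
  have IC : ideal_closed I by apply: ideal_addP.
  have Ipoly i : k != i -> exists2 q : {poly K}, q != 0 & I (eval1 'X_i q).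
    move=> ki; have [n [q [q0 sq lc]]] := welim ki.
    exists q => //; have [h Hh] := subst1_sub k 1 (binary_form k i n q).
    exists (binary_form k i n q), (- h); split=> //.
    rewrite mulrN -Hh opprB addrC subrK rmorph_binary_form.
    rewrite /= /horner_eval (@horner_coef_wide _ n.+1); last first.
      exact: leq_trans (size_poly _ _) sq.
    apply: eq_bigr => e _.
    by rewrite coef_map /= mmapC !mmapX !mmap1U eqxx eq_sym (negbTE ki) expr1n mul1r.
  have [qj qj0 Iqj] := Ipoly j kj; have [ql ql0 Iql] := Ipoly l kl.
  have [cj Ij1] := ideal_add_root IC I1 qj0 Iqj.
  have IjC := ideal_addP ('X_j - cj%:MP) IC.
  have [cl Il1] := ideal_add_root IjC Ij1 ql0 (ideal_add_sub _ Iql).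
  have [ID IM] := ideal_addP ('X_l - cl%:MP) IjC.
  pose p i := if i == k then 1 else if i == j then cj else cl.
  have Iself (J : R -> Prop) x : J 0 -> ideal_add J x x.
    by move=> J0; exists 0, 1; rewrite add0r mulr1.
  have I0 : lincomb w 0.
    by exists (fun=> 0); rewrite big1 // => i _; rewrite mul0r.
  have IX i : ideal_add (ideal_add I ('X_j - cj%:MP)) ('X_l - cl%:MP) ('X_i - (p i)%:MP).
    case: (ord3_cases kj kl jl i) => ->; rewrite /p ?eqxx.
    - by do 2 apply: ideal_add_sub; apply: Iself.
    - rewrite eq_sym (negbTE kj) ?eqxx.
      by apply: ideal_add_sub; apply: Iself; apply: ideal_add_sub.
    - rewrite eq_sym (negbTE kl) eq_sym (negbTE jl).
      by apply: Iself; do 2 apply: ideal_add_sub.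
  have [i wi] : exists i, (w i).@[p] != 0.
    by apply: wnozero; exists k; rewrite /p eqxx oner_eq0.
  apply: Il1.
  have -> : 1 = ((w i).@[p])^-1%:MP * (w i - \sum_t projT1 (cid (sub_meval p (w i))) t * ('X_t - (p t)%:MP)).
    by rewrite -(projT2 (cid (sub_meval p (w i)))) opprB addrC subrK -mpolyCM mulVf.
  apply: (IM); apply: (ID).
    do 3 apply: ideal_add_sub; exists (fun t => (t == i)%:R).
    by rewrite (bigD1 i) //= eqxx mul1r big1 ?addr0 // => t /negbTE ->; rewrite mul0r.
  rewrite -[- (\sum_t _)]mulN1r; apply: (IM); rewrite sum3 /=.
  by apply: (ID); [apply: (ID)|]; apply: (IM); apply: IX.
move=> [g [h [Wg e]]].
(* in degree [m + 1] the relation [1 = g + (X_k - 1) h] says that, modulo the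
   ideal, [h_(m+1)] is [X_k h_m], while [h_0] is [- 1] *)
have step m : lincomb w (homog_part m h + 'X_k ^+ m).
  elim: m => [|m IHm].
    have := congr1 (homog_part 0) e; rewrite homog_part_id ?dhomog1 // mulrBl mul1r raddfD raddfB /=.
    rewrite -['X_k]expr1 (homog_partM _ _ (homogXn _ _ _)) ltnn sub0r => /eqP.
    by rewrite -subr_eq opprK addrC expr0 => /eqP ->; apply: lincomb_homog_part.
  have := congr1 (homog_part m.+1) e.
  rewrite (@homog_part_ne _ _ 0) ?dhomog1 // mulrBl mul1r raddfD raddfB /=.
  rewrite -{1}['X_k]expr1 (homog_partM _ _ (homogXn _ _ _)) expr1 /= subn1 /=.
  move=> /esym/eqP; rewrite addrA subr_eq0 => /eqP <-.
  have -> : homog_part m.+1 g + 'X_k * homog_part m h + 'X_k ^+ m.+1 =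
    homog_part m.+1 g + 'X_k * (homog_part m h + 'X_k ^+ m) by rewrite exprS; ring.
  by apply: lincombD; [apply: lincomb_homog_part|apply: lincombMl].
exists (msize h); have := step (msize h).
by rewrite homog_part_large // add0r.
Qed.

Lemma nozero_regular : (0 < s)%N -> regular_sequence [:: w ix; w iy; w iz].
Proof.
move=> s_gt0; pose N k := projT1 (cid (power_in_ideal k)).
apply: (@koszul_regular _ _ _ whomog (N ix + N iy + N iz)) => // k.
have [m ->] : exists m, (N ix + N iy + N iz = m + N k)%N.
  exists (N ix + N iy + N iz - N k)%N; rewrite subnK //.
  by elim/ord3_ind: (k); rewrite -?addnA ?leq_addr // addnCA ?leq_addr // addnA leq_addl.
by rewrite exprD; apply: lincombMl; apply: (projT2 (cid (power_in_ideal k))).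
Qed.
End Nullstellensatz.

(** * A regular syzygy gives a free curve *)

Section CrossSpan.
Variables (K : closedFieldType).
Local Notation R := {mpoly K[3]}.
Implicit Types (a u v : 'I_3 -> R).
Variables (f : 'I_3 -> R).
Hypothesis felim : eliminable f.

Lemma eliminable_neq0 : exists i, f i != 0.
Proof.
apply: contrapT => /forallNP f0.
have [n [q [q0 sq [c ec]]]] := felim (isT : ix != iy).
suff e : binary_form ix iy n q = 0 by rewrite (binary_form_eq0 (isT : ix != iy) sq e) eqxx in q0.
rewrite ec big1 // => i _.
by have /negP := f0 i; rewrite negbK => /eqP ->; rewrite mulr0.
Qed.

Lemma orthogonal_cross a v : dot a f = 0 -> dot v f = 0 ->
  exists p, forall i, cross v a i = p * f i.
Proof.
move=> af vf; apply: (parallel_multiple felim).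
have e i : cross f (cross v a) i = 0.
  by rewrite cross_cross [dot f _]dotC [dot f v]dotC af vf !mulr0 subr0.
exact: cross0_parallel.
Qed.

(** For a syzygy [v], both [v x a] and [v x u] are parallel to [f], because [v],
    [a] and [u] are orthogonal to it; hence they are multiples of [f]. Subtracting
    from [v] the corresponding combination of [a] and [u] leaves a vector parallel
    to both [a] and [u], which is zero because [a x u] is not. *)
Lemma cross_span a u v : (forall i, cross a u i = f i) -> dot v f = 0 ->
  exists p q, forall i, v i = p * a i + q * u i.
Proof.
move=> auf vf.
have ef : f = cross a u by apply: funext => i; rewrite auf.
have af : dot a f = 0 by rewrite ef dot_cross_left.
have uf : dot u f = 0 by rewrite ef dot_cross_right.
have [p Hp] := orthogonal_cross af vf; have [q Hq] := orthogonal_cross uf vf.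
exists q, (- p).
(* this vector is parallel to [a] and to [u] *)
pose eta i := 1 * v i + - q * a i + p * u i.
have P i : cross eta a i = 0.
  by rewrite cross_combl crossvv (crossC u) auf Hp; ring.
have Q i : cross eta u i = 0.
  by rewrite cross_combl crossvv auf Hq; ring.
have [k fk] := eliminable_neq0.
have eta0 i : eta i = 0.
  by apply: (mulIf fk); rewrite mul0r -auf (mul_cross eta a u) P Q dotE !P; ring.
move=> i; apply/eqP; rewrite -subr_eq0 -(eta0 i) /eta; apply/eqP; ring.
Qed.
End CrossSpan.

Section Derivations.
Variables (K : fieldType).
Local Notation R := {mpoly K[3]}.
Implicit Types (v : 'I_3 -> R).

Definition der v : R -> R^o := fun p => \sum_i v i * p^`M(i).

Lemma der_derivation v : derivation (der v).
Proof.
split=> [a p q|p q]; rewrite /der.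
  rewrite scaler_sumr -big_split; apply: eq_bigr => i _ /=.
  by rewrite mderivD mderivZ mulrDr scalerAr.
rewrite mulr_suml mulr_sumr -big_split; apply: eq_bigr => i _ /=.
by rewrite mderivM; ring.
Qed.

Lemma der_X v i : der v 'X_i = v i.
Proof.
rewrite /der (bigD1 i) //= big1 => [|j ne_ji].
  by rewrite mderivX mnm1E eqxx scale1r -{1}[U_(i)%MM]add0m addmK mpolyX0 mulr1 addr0.
by rewrite mderivX mnm1E eq_sym (negbTE ne_ji) scale0r mulr0.
Qed.

Lemma derivationE (t : R -> R^o) : derivation t -> t = der (fun i => t 'X_i).
Proof.
move=> [tlin tM].
have tD p q : (t (p + q) : R) = (t p : R) + t q by have := tlin 1 p q; rewrite !scale1r.
have t0 : (t 0 : R) = 0.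
  by have /eqP := tD 0 0; rewrite addr0 -[X in X == _]addr0 (inj_eq (addrI _)) eq_sym => /eqP.
have t1 : (t 1 : R) = 0.
  have /eqP := tM 1 1; rewrite !mulr1 mul1r -[X in X == _]addr0 (inj_eq (addrI _)).
  by rewrite eq_sym => /eqP.
have tC c : (t c%:MP : R) = 0.
  by rewrite -[c%:MP]mulr1 mul_mpolyC -[_ *: _]addr0 tlin t1 t0 scaler0 addr0.
apply: funext => p.
rewrite (@derivation_chain 3 K R idfun (t : R -> R) tD tM tC) /der.
by apply: eq_bigr => i _; rewrite mulrC.
Qed.

Lemma der_comb n (a : 'I_n -> R) (v : 'I_n -> 'I_3 -> R) :
  \sum_(j < n) a j *: (der (v j) : R -> R^o) = der (fun i => \sum_(j < n) a j * v j i).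
Proof.
apply: funext => p; rewrite fct_sumE /der.
under [RHS]eq_bigr => i _ do rewrite mulr_suml.
rewrite exchange_big; apply: eq_bigr => j _ /=.
rewrite [LHS](_ : _ = a j * \sum_i v j i * p^`M(i)) // mulr_sumr.
by apply: eq_bigr => i _; rewrite mulrA.
Qed.

Variable F : R.

Lemma log_derivationsP (t : R -> R^o) : log_derivations F t <->
  derivation t /\ exists g, dot (fun i => t 'X_i) (fun i => F^`M(i)) = g * F.
Proof.
split=> [[td /ideal_gen1P [g tF]]|[td [g tF]]]; split=> //.
  by exists g; rewrite -tF [in RHS](derivationE td).
by apply/ideal_gen1P; exists g; rewrite -tF [in LHS](derivationE td).
Qed.

Lemma free_log_derivations (b : 'I_3 -> 'I_3 -> R) :
  (forall j, exists g, dot (b j) (fun i => F^`M(i)) = g * F) ->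
  (forall v g, dot v (fun i => F^`M(i)) = g * F ->
     exists c : 'I_3 -> R, forall i, v i = \sum_j c j * b j i) ->
  (forall c : 'I_3 -> R, (forall i, \sum_j c j * b j i = 0) -> forall j, c j = 0) ->
  free_curve F.
Proof.
move=> blog bspan bfree.
have derX v : (fun i => der v 'X_i) = v by apply: funext => i; rewrite der_X.
exists [set t | exists j, t = der (b j)]%classic; split.
- move=> _ [j ->]; apply/log_derivationsP; split; first exact: der_derivation.
  by rewrite derX; apply: blog.
- move=> t /log_derivationsP [td [g tg]].
  have [c ec] := bspan _ _ tg.
  exists 3, (fun j => der (b j)), c; split; first by move=> j; exists j.
  by rewrite der_comb {1}(derivationE td); congr der; apply: funext.
- move=> n t a tinj tB sum0.
  pose sig i := projT1 (cid (tB i)).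
  have Hsig i : t i = der (b (sig i)) by exact: (projT2 (cid (tB i))).
  have sig_inj : injective sig by move=> i i' e; apply: tinj; rewrite !Hsig e.
  have H : forall j, \sum_(i < n | sig i == j) a i = 0.
    apply: bfree => k.
    have : \sum_(i < n) a i * b (sig i) k = 0.
      have e : (\sum_(i < n) a i *: t i) 'X_k = 0 by rewrite sum0.
      rewrite -[RHS]e (eq_bigr (fun i => a i *: (der (b (sig i)) : R -> R^o))).
        by rewrite der_comb der_X.
      by move=> i _; rewrite Hsig.
    rewrite (partition_big sig predT) //= => e; rewrite -[RHS]e; apply: eq_bigr => j _.
    by rewrite mulr_suml; apply: eq_bigr => i /eqP ->.
  move=> i; have := H (sig i); rewrite (bigD1 i) //= big1 ?addr0 // => i'.
  by case/andP => /eqP /sig_inj ->; rewrite eqxx.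
Qed.
End Derivations.

Section RegularToFree.
Variables (K : numClosedFieldType).
Local Notation R := {mpoly K[3]}.
Variables (F : R) (d : nat).
Hypotheses (Fhomog : F \is d.-homog) (d_gt0 : (0 < d)%N) (F0 : F != 0).
Let f i := F^`M(i).
Hypothesis felim : eliminable f.

Lemma dot_euler : dot (fun i => 'X_i) f = d%:R *: F.
Proof. exact: euler_homog. Qed.

(** The Euler derivation splits off the logarithmic derivations: since the degree
    is invertible, subtracting a multiple of it from a derivation with
    [t F = g F] leaves a syzygy of the gradient, to which [cross_span] applies. *)
Lemma cross_free a u : (forall i, cross a u i = f i) -> free_curve F.
Proof.
move=> auf.
have ef : f = cross a u by apply: funext => i; rewrite auf.
have af : dot a f = 0 by rewrite ef dot_cross_left.
have uf : dot u f = 0 by rewrite ef dot_cross_right.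
have dK : d%:R != 0 :> K by rewrite pnatr_eq0 -lt0n.
pose b j : 'I_3 -> R := if j == ix then (fun i => 'X_i) else if j == iy then a else u.
have dotD (c : 'I_3 -> R) (v : 'I_3 -> 'I_3 -> R) :
    dot (fun i => \sum_j c j * v j i) f = \sum_j c j * dot (v j) f.
  rewrite /dot; under eq_bigr => i _ do rewrite mulr_suml.
  rewrite exchange_big; apply: eq_bigr => j _.
  by rewrite mulr_sumr; apply: eq_bigr => i _; rewrite mulrA.
apply: (free_log_derivations (b := b)).
- move=> j; rewrite -/f; elim/ord3_ind: j; rewrite /b /=.
  + by exists d%:R%:MP; rewrite dot_euler mul_mpolyC.
  + by exists 0; rewrite af mul0r.
  + by exists 0; rewrite uf mul0r.
- move=> v g; rewrite -/f => vf.
  pose c0 := d%:R^-1 *: g.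
  have : dot (fun i => v i - c0 * 'X_i) f = 0.
    transitivity (dot v f - c0 * dot (fun i => 'X_i) f); first by rewrite !dotE; ring.
    by rewrite vf dot_euler /c0 -scalerAl -scalerAr scalerA mulVf // scale1r subrr.
  move=> /(cross_span felim auf) [p [q pq]].
  exists (fun j => if j == ix then c0 else if j == iy then p else q) => i.
  by rewrite sum3 /b /= -addrA -pq addrC subrK.
- move=> c csum.
  have c0 : c ix = 0.
    have := dotD c b; rewrite [in RHS]sum3 /b /= af uf dot_euler !mulr0 !addr0.
    rewrite (_ : (fun i => \sum_j _) = fun=> 0); last exact: funext.
    rewrite {1}/dot big1 => [/esym/eqP|i _]; last by rewrite mul0r.
    rewrite -scalerAr scaler_eq0 (negbTE dK) mulf_eq0 (negbTE F0) orbF.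
    by move=> /eqP.
  have e i : c iy * a i + c iz * u i = 0.
    by have := csum i; rewrite sum3 /b /= c0 mul0r add0r.
  have [k fk] := eliminable_neq0 felim.
  have c1 : c iy = 0.
    apply: (mulIf fk); rewrite mul0r -auf.
    transitivity (cross (fun i => c iy * a i + c iz * u i) u k).
      by elim/ord3_ind: (k); rewrite /cross /=; ring.
    by elim/ord3_ind: (k); rewrite /cross /= !e; ring.
  have c2 : c iz = 0.
    apply: (mulIf fk); rewrite mul0r -auf.
    transitivity (cross a (fun i => c iy * a i + c iz * u i) k).
      by elim/ord3_ind: (k); rewrite /cross /=; ring.
    by elim/ord3_ind: (k); rewrite /cross /= !e; ring.
  exact: ord3_ind.
Qed.

(** The gradient is itself a relation between the entries of the regular sequence
    [w], hence a Koszul relation, that is, a cross product with [w]. *)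
Lemma regular_syzygy_free (w : 'I_3 -> R) :
  dot w f = 0 -> regular_sequence [:: w ix; w iy; w iz] -> free_curve F.
Proof.
move=> wf /regular_sequence3P [r0 r1 r2 _].
rewrite dotE in wf.
have [al [be fz]] : exists x y, f iz = x * w ix + y * w iy.
  apply: r2; exists (- f ix), (- f iy); apply/eqP; rewrite -subr_eq0 -wf; apply/eqP; ring.
have [ga fy] : exists x, f iy + be * w iz = x * w ix.
  apply: r1; exists (- (f ix + al * w iz)); apply/eqP; rewrite -subr_eq0 -wf fz.
  by apply/eqP; ring.
have fx : f ix = - al * w iz - ga * w iy.
  apply/eqP; rewrite -subr_eq0; apply/eqP; apply: r0; rewrite -wf fz.
  have -> : f iy = ga * w ix - be * w iz by rewrite -fy addrK.
  ring.
apply: (@cross_free w (fun i => if i == ix then - be else if i == iy then al else - ga)).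
elim/ord3_ind; rewrite /cross /= ?fx ?fz; try ring.
by rewrite -[LHS]opprK; have -> : f iy = ga * w ix - be * w iz by [rewrite -fy addrK]; ring.
Qed.
End RegularToFree.

(** * Powers of the maximal ideal of a point *)

Section PowerIdeal.
Variables (A : comNzRingType) (y : 'I_3 -> A).

Fixpoint ideal_power (k : nat) (h : A) : Prop :=
  if k is k'.+1 then
    exists g : 'I_3 -> A, (forall i, ideal_power k' (g i)) /\ h = \sum_i g i * y i
  else True.

Lemma ideal_powerD k g h : ideal_power k g -> ideal_power k h -> ideal_power k (g + h).
Proof.
elim: k g h => [|k IH] g0 h0; first by [].
move=> [g [Hg ->]] [h [Hh ->]].
exists (fun i => g i + h i); split=> [i|]; first exact: (IH _ _ (Hg i) (Hh i)).
by rewrite -big_split; apply: eq_bigr => i _; rewrite mulrDl.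
Qed.

Lemma ideal_powerMl k a h : ideal_power k h -> ideal_power k (a * h).
Proof.
elim: k h => [|k IH] h0; first by [].
move=> [h [Hh ->]].
exists (fun i => a * h i); split=> [i|]; first exact: (IH _ (Hh i)).
by rewrite mulr_sumr; apply: eq_bigr => i _; rewrite mulrA.
Qed.

Lemma ideal_powerMr k a h : ideal_power k h -> ideal_power k (h * a).
Proof. by rewrite mulrC; apply: ideal_powerMl. Qed.

Lemma ideal_power0 k : ideal_power k 0.
Proof.
elim: k => [|k IH]; first exact: (fun=> Logic.I).
exists (fun=> 0); split=> //.
by rewrite big1 // => i _; rewrite mul0r.
Qed.

Lemma ideal_powerN k h : ideal_power k h -> ideal_power k (- h).
Proof. by rewrite -mulN1r; apply: ideal_powerMl. Qed.

Lemma ideal_powerB k g h : ideal_power k g -> ideal_power k h -> ideal_power k (g - h).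
Proof. by move=> Hg Hh; apply: ideal_powerD => //; apply: ideal_powerN. Qed.

Lemma ideal_power_sum k (I : Type) (r : seq I) (P : pred I) (h : I -> A) :
  (forall i, P i -> ideal_power k (h i)) -> ideal_power k (\sum_(i <- r | P i) h i).
Proof. by move=> H; apply: big_ind => //; [exact: ideal_power0|exact: ideal_powerD]. Qed.

Lemma ideal_powerS k h : ideal_power k.+1 h -> ideal_power k h.
Proof.
by move=> [g [Hg ->]]; apply: ideal_power_sum => i _; apply: ideal_powerMr; apply: Hg.
Qed.

Lemma ideal_power_le k l h : (k <= l)%N -> ideal_power l h -> ideal_power k h.
Proof.
move=> /subnK <-; elim: (l - k)%N => [|m IH]; first by rewrite add0n.
by rewrite addSn => /ideal_powerS.
Qed.

Lemma ideal_powerM k l g h : ideal_power k g -> ideal_power l h -> ideal_power (k + l) (g * h).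
Proof.
move=> + Hh; elim: k g => [|k IH] g; first by move=> _; apply: ideal_powerMl.
move=> [c [Hc ->]]; rewrite addSn; exists (fun i => c i * h); split=> [i|]; first exact: (IH _ (Hc i)).
by rewrite mulr_suml; apply: eq_bigr => i _; rewrite mulrAC.
Qed.

Lemma ideal_powerX k g : ideal_power 1 g -> ideal_power k (g ^+ k).
Proof.
move=> Hg; elim: k => [|k IH]; [exact: Logic.I|]; rewrite exprS; exact: (@ideal_powerM 1 k).
Qed.

(** Pigeonhole on the exponents of a monomial in the three generators. *)
Lemma ideal_power_split (e : 'I_3 -> nat) h : ideal_power (\sum_i e i) h ->
  exists u : 'I_3 -> A, h = \sum_i u i * y i ^+ e i.
Proof.
move en : (\sum_i e i)%N => n; elim: n e en h => [|n IH] e en h.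
  move=> _; exists (fun i => if i == ix then h else 0).
  have e0 : e ix = 0%N by apply/eqP; rewrite -leqn0 -en (bigD1 ix) //= leq_addr.
  by rewrite sum3 /= e0; ring.
move=> [g [Hg ->]].
have [[i ei]|pos] := pselect (exists i, e i = 0%N).
  exists (fun j => if j == i then \sum_i g i * y i else 0).
  rewrite [RHS](bigD1 i) //= eqxx ei mulr1 [X in _ + X]big1 ?addr0 // => j /negbTE ->.
  by rewrite mul0r.
have {}pos i : (0 < e i)%N.
  by rewrite lt0n; apply/eqP => ei; apply: pos; exists i.
have H i : exists u : 'I_3 -> A, g i * y i = \sum_j u j * y j ^+ e j.
  pose e' j := (if j == i then (e j).-1 else e j).
  have [|u Hu] := IH e' _ (g i) (Hg i).
    have -> : (\sum_j e' j = (e i).-1 + \sum_(j | j != i) e j)%N.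
      rewrite (bigD1 i) //= {1}/e' eqxx; congr addn.
      by apply: eq_bigr => j /negbTE; rewrite /e' => ->.
    by move: en (pos i); rewrite (bigD1 i) //=; case: (e i) => // k; rewrite addSn => -[].
  exists (fun j => if j == i then u j else u j * y i).
  rewrite Hu mulr_suml; apply: eq_bigr => j _; rewrite /e'.
  case: eqP => [->|_]; last by rewrite mulrAC.
  by rewrite -mulrA -exprSr prednK.
exists (fun j => \sum_i projT1 (cid (H i)) j).
under [RHS]eq_bigr => j _ do rewrite mulr_suml.
by rewrite exchange_big; apply: eq_bigr => i _; apply: (projT2 (cid (H i))).
Qed.

Lemma ideal_power_splitS (e : 'I_3 -> nat) h : ideal_power (\sum_i e i).+1 h ->
  exists u : 'I_3 -> A, (forall i, ideal_power 1 (u i)) /\ h = \sum_i u i * y i ^+ e i.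
Proof.
move=> [g [Hg ->]]; pose u i := projT1 (cid (ideal_power_split (Hg i))).
have Hu i : g i = \sum_j u i j * y j ^+ e j := projT2 (cid (ideal_power_split (Hg i))).
exists (fun j => \sum_i u i j * y i); split=> [j|]; first by exists (u^~ j).
under [RHS]eq_bigr => j _ do rewrite mulr_suml.
rewrite exchange_big; apply: eq_bigr => i _ /=.
by rewrite Hu mulr_suml; apply: eq_bigr => j _; rewrite mulrAC.
Qed.
End PowerIdeal.

Arguments ideal_power : simpl never.

(** * Polynomials in two local parameters *)

(** The coefficient of [u^i v^j] in [x : {poly {poly K}}] is [x`_i`_j]. *)

Section TwoVariables.
Variables (K : fieldType).
Local Notation B := {poly {poly K}}.

Lemma poly2_closure_ind (P : B -> Prop) :
  (forall c : K, P c%:P%:P) -> P 'X -> P 'X%:P ->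
  (forall x z, P x -> P z -> P (x + z)) ->
  (forall x z, P x -> P z -> P (x * z)) -> forall x, P x.
Proof.
move=> PC PX PY PD PM.
have PC1 (q : {poly K}) : P q%:P.
  elim/poly_ind: q => [|q c IH]; first exact: (PC 0).
  by rewrite polyCD polyCM; apply: PD => //; apply: PM.
elim/poly_ind => [|q c IH]; first exact: (PC 0).
by apply: (PD) => //; apply: PM.
Qed.

Lemma coef2M (x z : B) i j : (x * z)`_i`_j =
  \sum_(k < i.+1) \sum_(l < j.+1) x`_k`_l * z`_(i - k)`_(j - l).
Proof. by rewrite coefM coef_sum; apply: eq_bigr => k _; rewrite coefM. Qed.

Lemma poly2P (x z : B) : (forall i j, x`_i`_j = z`_i`_j) -> x = z.
Proof. by move=> e; apply/polyP => i; apply/polyP => j. Qed.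

(** Membership in the ideal generated by [u^(M+1)] and [v^(M+1)]. *)
Definition vanish2 M (x : B) := forall i j, (i <= M)%N -> (j <= M)%N -> x`_i`_j = 0.

Lemma vanish2D M x z : vanish2 M x -> vanish2 M z -> vanish2 M (x + z).
Proof. by move=> Hx Hz i j hi hj; rewrite !coefD Hx ?Hz ?addr0. Qed.

Lemma vanish2N M x : vanish2 M x -> vanish2 M (- x).
Proof. by move=> Hx i j hi hj; rewrite !coefN Hx ?oppr0. Qed.

Lemma vanish2Ml M x z : vanish2 M z -> vanish2 M (x * z).
Proof.
move=> Hz i j hi hj; rewrite coef2M big1 // => k _; rewrite big1 // => l _.
by rewrite Hz ?mulr0 // (leq_trans (leq_subr _ _)).
Qed.

(** The weighted Euler derivation [al u d/du + be v d/dv]. *)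
Definition weight_der (al be : K) (x : B) : B :=
  \poly_(i < size x) \poly_(j < size x`_i) ((al * i%:R + be * j%:R) * x`_i`_j).

Lemma coef_weight_der al be x i j :
  (weight_der al be x)`_i`_j = (al * i%:R + be * j%:R) * x`_i`_j.
Proof.
rewrite coef_poly; case: ltnP => hi; last first.
  by rewrite coef0 (nth_default _ hi) coef0 mulr0.
by rewrite coef_poly; case: ltnP => // hj; rewrite (nth_default _ hj) mulr0.
Qed.

Lemma weight_derD al be x z :
  weight_der al be (x + z) = weight_der al be x + weight_der al be z.
Proof.
by apply: poly2P => i j; rewrite !coefD !coef_weight_der !coefD mulrDr.
Qed.

Lemma weight_derM al be x z :
  weight_der al be (x * z) = weight_der al be x * z + x * weight_der al be z.
Proof.
apply: poly2P => i j; rewrite !coefD coef_weight_der !coef2M mulr_sumr -big_split.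
apply: eq_bigr => k _; rewrite mulr_sumr -big_split; apply: eq_bigr => l _ /=.
rewrite !coef_weight_der.
have ki : (k <= i)%N by rewrite -ltnS.
have lj : (l <= j)%N by rewrite -ltnS.
by rewrite (natrB _ ki) (natrB _ lj); ring.
Qed.

Lemma weight_derC al be c : weight_der al be c%:P%:P = 0.
Proof.
apply: poly2P => i j; rewrite coef_weight_der !coef0 coefC.
case: i => [|i] /=; last by rewrite coef0 mulr0.
by rewrite coefC; case: j => [|j] /=; rewrite ?mulr0 // addr0 mul0r.
Qed.

Local Notation R := {mpoly K[3]}.

Definition eval2 (U V : R) : {rmorphism B -> R} := horner_eval U \o map_poly (eval1 V).

Lemma eval2E U V x : eval2 U V x =
  \sum_(i < size x) \sum_(j < size x`_i) (x`_i`_j)%:MP * V ^+ j * U ^+ i.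
Proof.
have e1 (q : {poly K}) : eval1 V q = \sum_(j < size q) (q`_j)%:MP * V ^+ j.
  rewrite [LHS](_ : _ = (map_poly (@mpolyC 3 K) q).[V]) //.
  rewrite (@horner_coef_wide _ (size q)); last exact: size_poly.
  by apply: eq_bigr => j _; rewrite coef_map.
rewrite [LHS](_ : _ = (map_poly (eval1 V) x).[U]) //.
rewrite (@horner_coef_wide _ (size x)); last exact: size_poly.
by apply: eq_bigr => i _; rewrite coef_map -mulr_suml; congr (_ * _); apply: e1.
Qed.

Lemma eval2C U V c : eval2 U V c%:P%:P = c%:MP.
Proof. by rewrite /= map_polyC /= map_polyC /= /horner_eval !hornerC. Qed.
Lemma eval2X U V : eval2 U V 'X = U.
Proof. by rewrite /= map_polyX /horner_eval hornerX. Qed.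
Lemma eval2Y U V : eval2 U V 'X%:P = V.
Proof. by rewrite /= map_polyC /= map_polyX /= /horner_eval hornerC hornerX. Qed.

Variable p : 'I_3 -> K.
Local Notation mp := (ideal_power (fun i => 'X_i - (p i)%:MP : R)).

Lemma eval2_vanish M x U V : mp 1 U -> mp 1 V -> vanish2 M x -> mp M.+1 (eval2 U V x).
Proof.
move=> hU hV hx.
rewrite eval2E; apply: ideal_power_sum => i _; apply: ideal_power_sum => j _.
have [hi|hi] := leqP i M; last by apply: ideal_powerMl; apply: ideal_power_le (ideal_powerX _ hU).
have [hj|hj] := leqP j M.
  by rewrite hx // mpolyC0 !mul0r; apply: ideal_power0.
by apply: ideal_powerMr; apply: ideal_powerMl; apply: ideal_power_le (ideal_powerX _ hV).
Qed.

Lemma eval2_const x U V : mp 1 U -> mp 1 V -> mp 1 (eval2 U V x - (x`_0`_0)%:MP).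
Proof.
move=> hU hV; rewrite -(eval2C U V) -rmorphB; apply: eval2_vanish => // i j.
by rewrite !leqn0 => /eqP -> /eqP ->; rewrite !coefB !coefC /= subrr.
Qed.

(** First-order Taylor expansion; only the value of the gradient at the origin
    matters modulo one more power of the maximal ideal. *)
Lemma eval2_linear M x U V dU dV : mp 1 U -> mp 1 V -> mp M.+1 dU -> mp M.+1 dV ->
  mp M.+2 (eval2 (U + dU) (V + dV) x - eval2 U V x
    - ((x`_1`_0)%:MP * dU + (x`_0`_1)%:MP * dV)).
Proof.
move=> hU hV hdU hdV.
have hU' : mp 1 (U + dU) by apply: ideal_powerD => //; apply: ideal_power_le hdU.
have hV' : mp 1 (V + dV) by apply: ideal_powerD => //; apply: ideal_power_le hdV.
elim/poly2_closure_ind: x => [c|||x z Hx Hz|x z Hx Hz].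
- rewrite !eval2C !coefC /= ?coef0 mpolyC0 (_ : _ - _ - _ = 0); last by ring.
  exact: ideal_power0.
- rewrite !eval2X !coefX /= ?coef1 ?coef0 mpolyC0 mpolyC1 (_ : _ - _ - _ = 0); last by ring.
  exact: ideal_power0.
- rewrite !eval2Y !coefC /= ?coef0 coefX mpolyC0 mpolyC1 (_ : _ - _ - _ = 0); last by ring.
  exact: ideal_power0.
- rewrite !rmorphD !coefD !mpolyCD.
  set e1 := _ - _ - _ in Hx; set e2 := _ - _ - _ in Hz.
  by rewrite (_ : _ - _ - _ = e1 + e2); [apply: ideal_powerD|rewrite /e1 /e2; ring].
have e10 : (x * z)`_1`_0 = x`_0`_0 * z`_1`_0 + x`_1`_0 * z`_0`_0.
  by rewrite coef2M !big_ord_recl !big_ord0 /= !addr0.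
have e01 : (x * z)`_0`_1 = x`_0`_0 * z`_0`_1 + x`_0`_1 * z`_0`_0.
  by rewrite coef2M !big_ord_recl !big_ord0 /= !addr0.
rewrite e10 e01 !rmorphM !mpolyCD !mpolyCM.
have hz := eval2_const z hU hV; have hx := eval2_const x hU' hV'.
move: Hx Hz hz hx.
set x' := eval2 _ _ x; set z' := eval2 _ _ z.
set x1 := eval2 _ _ x; set z1 := eval2 _ _ z.
set lx := _ * dU + _; set lz := _ * dU + _ => Hx Hz hz hx.
have hl (c c' : R) : mp M.+1 (c * dU + c' * dV).
  by apply: ideal_powerD; apply: ideal_powerMl.
rewrite (_ : _ - _ - _ = x' * (z' - z1 - lz) + (x' - x1 - lx) * z1
   + (x' - (x`_0`_0)%:MP) * lz + lx * (z1 - (z`_0`_0)%:MP)).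
  apply: ideal_powerD; last by rewrite mulrC; apply: (@ideal_powerM _ _ 1 M.+1) => //; apply: hl.
  apply: ideal_powerD; last by apply: (@ideal_powerM _ _ 1 M.+1) => //; apply: hl.
  by apply: ideal_powerD; [apply: ideal_powerMl|apply: ideal_powerMr].
rewrite /lx /lz; ring.
Qed.

Lemma ideal_power1_meval h : mp 1 h <-> h.@[p] = 0.
Proof.
split=> [[g [_ ->]]|h0].
  by rewrite rmorph_sum big1 // => i _; rewrite rmorphM rmorphB /= mevalXU mevalC subrr mulr0.
by have [g] := sub_meval p h; rewrite h0 mpolyC0 subr0 => ->; exists g.
Qed.
End TwoVariables.

(** * The formal syzygy at a quasihomogeneous point *)

Section SeriesRepresentation.
Variables (K : fieldType).
Local Notation B := {poly {poly K}}.
Variable M : nat.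

(** Power series enter the argument through such polynomial approximations only;
    the order [M] is arbitrary. *)
Definition represents (x : B) (a : series2 K) :=
  forall i j, (i <= M)%N -> (j <= M)%N -> x`_i`_j = a i j.

Definition truncation (a : series2 K) : B := \poly_(i < M.+1) \poly_(j < M.+1) a i j.

Lemma truncationP a : represents (truncation a) a.
Proof. by move=> i j hi hj; rewrite coef_poly ltnS hi coef_poly ltnS hj. Qed.

Lemma represents1 : represents 1 (@series2_one K).
Proof.
move=> i j _ _; rewrite /series2_one coef1; case: i => [|i] /=; last by rewrite coef0.
by rewrite coef1.
Qed.

Lemma representsM x z a b : represents x a -> represents z b ->
  represents (x * z) (series2_mul a b).
Proof.
move=> xa zb i j hi hj; rewrite coef2M; apply: eq_bigr => k _; apply: eq_bigr => l _.
rewrite xa ?zb // ?(leq_trans (leq_subr _ _)) //.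
  by rewrite (leq_trans _ hi) // -ltnS.
by rewrite (leq_trans _ hj) // -ltnS.
Qed.

Lemma representsX x a n : represents x a -> represents (x ^+ n) (series2_exp a n).
Proof.
move=> xa; elim: n => [|n IH]; first exact: represents1.
by rewrite exprS; apply: representsM.
Qed.

Lemma represents_prod n (x : 'I_n -> B) (a : 'I_n -> series2 K) :
  (forall k, represents (x k) (a k)) ->
  represents (\prod_k x k) (\big[@series2_mul K/@series2_one K]_k a k).
Proof.
move=> xa; apply: (big_ind2 represents); first exact: represents1.
  by move=> *; apply: representsM.
by move=> k _; apply: xa.
Qed.

Definition polyCC : {rmorphism K -> B} := polyC \o polyC.
Definition compose2 n (x : 'I_n -> B) : {rmorphism {mpoly K[n]} -> B} := mmap polyCC x.

Lemma compose2C n (x : 'I_n -> B) c : compose2 x c%:MP = c%:P%:P.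
Proof. by rewrite /= mmapC. Qed.
Lemma compose2X n (x : 'I_n -> B) i : compose2 x 'X_i = x i.
Proof. by rewrite /= mmapX mmap1U. Qed.

Lemma represents_subst n (F : {mpoly K[n]}) (x : 'I_n -> B) (s : 'I_n -> series2 K) :
  (forall k, represents (x k) (s k)) -> represents (compose2 x F) (series2_subst F s).
Proof.
move=> xs i j hi hj.
rewrite [compose2 x F](_ : _ = \sum_(m <- msupp F) polyCC F@_m * mmap1 x m) //.
rewrite /series2_subst !coef_sum; apply: eq_bigr => m _.
rewrite /= coefCM coefCM; congr (_ * _).
by apply: represents_prod => // k; apply: representsX.
Qed.

Lemma compose2_const n (F : {mpoly K[n]}) (x : 'I_n -> B) :
  (compose2 x F)`_0`_0 = F.@[fun k => (x k)`_0`_0].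
Proof.
elim/mpoly_closure_ind: F => [c|i|f g Hf Hg|f g Hf Hg].
- by rewrite compose2C mevalC !coefC.
- by rewrite compose2X mevalXU.
- by rewrite rmorphD mevalD -Hf -Hg !coefD.
- by rewrite rmorphM mevalM -Hf -Hg !coef0M.
Qed.
End SeriesRepresentation.

Section FormalSyzygy.
Variables (K : numFieldType).
Local Notation R := {mpoly K[3]}.
Local Notation B := {poly {poly K}}.
Variables (F : R) (d : nat).
Hypotheses (Fhomog : F \is d.-homog) (d_gt0 : (0 < d)%N).
Variable (p : 'I_3 -> K).
Hypothesis psing : forall k, (F^`M(k)).@[p] = 0.
Variables (s : 'I_3 -> series2 K) (e : series2 K) (g : {mpoly K[2]}).
Hypotheses (sp : forall k, s k 0%N 0%N = p k) (e0 : e 0%N 0%N != 0).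
Hypothesis gweighted : weighted_homogeneous g.
Hypothesis Fseg : forall i j,
  series2_subst F s i j = series2_mul e (series2_of_poly g) i j.

Lemma singular_on_curve : F.@[p] = 0.
Proof.
have := congr1 (meval p) (euler_homog Fhomog).
rewrite rmorph_sum big1 => [|i _]; last by rewrite rmorphM /= psing mulr0.
by move/esym/eqP; rewrite mevalZ mulf_eq0 pnatr_eq0 -leqn0 leqNgt d_gt0 => /eqP.
Qed.

(** The weight is nonzero because all weights are positive and the curve passes
    through the point, so that a weighted homogeneous equation has no constant
    term. A zero equation has every weight, in particular 1. *)
Lemma weighted_degree : exists al be w : K, w != 0 /\
  forall i j, series2_of_poly g i j != 0 -> al * i%:R + be * j%:R = w.
Proof.
have [al [be [w [al_gt0 be_gt0 gw]]]] := gweighted.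
have H i j : series2_of_poly g i j != 0 -> al * i%:R + be * j%:R = w.
  move=> gij; have := gw [multinom [tuple i; j]]; rewrite mcoeff_msupp => /(_ gij).
  by rewrite !(mnm_nth 0%N).
exists (ratr al), (ratr be).
have [[i [j gij]]|g0] := pselect (exists i j, series2_of_poly g i j != 0); last first.
  exists 1; split=> [|i j gij]; first exact: oner_neq0.
  by case: g0; exists i, j.
exists (ratr w); split=> [|i' j' /H <-]; last by rewrite rmorphD !rmorphM !rmorph_nat.
rewrite fmorph_eq0 -(H _ _ gij).
have : (0 < i + j)%N.
  rewrite lt0n addn_eq0; apply/negP => /andP[/eqP i0 /eqP j0]; move: gij.
  rewrite i0 j0; apply/negP; rewrite negbK.
  have := Fseg 0 0; have xs k : represents 0 (truncation 0 (s k)) (s k) by apply: truncationP.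
  rewrite -(represents_subst F xs (leqnn _) (leqnn _)) compose2_const.
  rewrite (@meval_eq _ _ _ p) => [|k]; last by rewrite truncationP.
  rewrite singular_on_curve /series2_mul !big_ord_recl !big_ord0 !addr0 /= !subnn.
  by move=> /esym/eqP; rewrite mulf_eq0 (negbTE e0).
rewrite addn_gt0 => /orP[] h; rewrite gt_eqF //.
  by apply: ltr_wpDr; [rewrite mulr_ge0 ?ler0n ?ltW|rewrite mulr_gt0 ?ltr0n].
by apply: ltr_wpDl; [rewrite mulr_ge0 ?ler0n ?ltW|rewrite mulr_gt0 ?ltr0n].
Qed.

(** Let [eta] be the weighted Euler derivation, so that [eta g = w g]. Since
    [F(s) = e g], one gets [e (eta F(s)) = h F(s)] with [h = eta e + w e]. By the
    chain rule [eta F(s)] is a combination of the partial derivatives of [F] at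
    [s], and by Euler's formula so is [d F(s)]; comparing the two gives a relation
    between these partial derivatives, with coefficients
    [theta = h s - d e (eta s)]. At the origin [eta s] vanishes, so [theta] takes
    there the value [w e(0) p], which is nonzero. Only truncations of the
    power series are used, at an arbitrarily high order. *)
Lemma formal_syzygy M : exists (S theta : 'I_3 -> B) (c : K), [/\ c != 0,
  forall k, represents M (S k) (s k),
  forall k, (theta k)`_0`_0 = c * p k
  & vanish2 M (\sum_k theta k * compose2 S F^`M(k))].
Proof.
have [al [be [w [w0 gw]]]] := weighted_degree.
pose eta := weight_der al be.
pose S k := truncation M (s k); pose E := truncation M e.
pose G := truncation M (series2_of_poly g).
have SP k : represents M (S k) (s k) by apply: truncationP.
have etaG : vanish2 M (eta G - w%:P%:P * G).
  move=> i j hi hj; rewrite !coefB coef_weight_der coefCM coefCM truncationP //.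
  have [->|gij] := eqVneq (series2_of_poly g i j) 0; first by rewrite !mulr0 subrr.
  by rewrite (gw _ _ gij) subrr.
have FEG : vanish2 M (compose2 S F - E * G).
  move=> i j hi hj; rewrite !coefB (represents_subst F SP hi hj) Fseg.
  have := representsM (@truncationP _ M e) (@truncationP _ M (series2_of_poly g)) hi hj.
  by rewrite -/E -/G => ->; rewrite subrr.
have eta_vanish x : vanish2 M x -> vanish2 M (eta x).
  by move=> hx i j hi hj; rewrite coef_weight_der hx ?mulr0.
have chain : eta (compose2 S F) = \sum_k compose2 S F^`M(k) * eta (S k).
  pose delta x := eta (compose2 S x).
  have -> : eta (compose2 S F) = delta F by [].
  rewrite (@derivation_chain 3 K B (compose2 S) delta); rewrite /delta.
  - by apply: eq_bigr => k _; rewrite compose2X.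
  - by move=> x z; rewrite rmorphD /eta weight_derD.
  - by move=> x z; rewrite rmorphM /eta weight_derM.
  - by move=> c; rewrite compose2C /eta weight_derC.
have euler : \sum_k S k * compose2 S F^`M(k) = d%:R * compose2 S F.
  have := congr1 (compose2 S) (euler_homog Fhomog).
  rewrite rmorph_sum -mul_mpolyC rmorphM compose2C !polyC_natr => <-.
  by apply: eq_bigr => k _; rewrite rmorphM compose2X.
pose h := eta E + w%:P%:P * E.
exists S, (fun k => h * S k - d%:R * E * eta (S k)), (w * e 0%N 0%N); split=> //.
- by rewrite mulf_neq0.
- move=> k; rewrite !coefB !coef0M coef_weight_der !mulr0 addr0 mul0r mulr0 subr0.
  rewrite !coefD !coef0M coef_weight_der !mulr0 addr0 mul0r add0r !coefC /=.
  by rewrite !truncationP // sp.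
have -> : \sum_k (h * S k - d%:R * E * eta (S k)) * compose2 S F^`M(k) =
    d%:R * (h * compose2 S F - E * eta (compose2 S F)).
  rewrite chain mulrBr mulrCA -euler !mulr_sumr -sumrB; apply: eq_bigr => k _; ring.
apply: vanish2Ml.
(* the error is expressed through those of [F(s) = e g] and [eta g = w g] *)
have -> : h * compose2 S F - E * eta (compose2 S F) =
    h * (compose2 S F - E * G) - E * eta (compose2 S F - E * G)
    - E * E * (eta G - w%:P%:P * G).
  have -> : eta (compose2 S F) = eta (compose2 S F - E * G) + eta (E * G).
    by rewrite -weight_derD subrK.
  by rewrite {2}/eta weight_derM -/eta /h; ring.
apply: vanish2D; last by apply: vanish2N; apply: vanish2Ml.
apply: vanish2D; first exact: vanish2Ml.
by apply: vanish2N; apply: vanish2Ml; apply: eta_vanish.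
Qed.
End FormalSyzygy.

(** * From the formal syzygy to a polynomial one *)

Section LocalParametrization.
Variables (K : fieldType).
Local Notation R := {mpoly K[3]}.
Local Notation B := {poly {poly K}}.
Variables (p : 'I_3 -> K) (S : 'I_3 -> B).
Local Notation mp := (ideal_power (fun i => 'X_i - (p i)%:MP : R)).
Hypothesis Sp : forall k, (S k)`_0`_0 = p k.
Hypothesis Sjac :
  \det (\matrix_(k < 3, l < 3) [:: p k; (S k)`_1`_0; (S k)`_0`_1]`_l) != 0.

(** The map [(c, u, v) |-> c s(u, v)] is a local isomorphism onto a neighbourhood
    of [p] in affine space, its differential at [(1, 0, 0)] having the columns
    [s], [ds/du], [ds/dv]. Newton's iteration inverts it to any order by
    polynomials [c], [U], [V] in the affine coordinates. *)
Lemma newton_inverse M : exists c U V : R, [/\ mp 1 (c - 1), mp 1 U, mp 1 V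
  & forall k, mp M.+1 ('X_k - c * eval2 U V (S k))].
Proof.
elim: M => [|M [c [U [V [hc hU hV H]]]]].
  exists 1, 0, 0; split; rewrite ?subrr; try exact: ideal_power0.
  move=> k; apply/ideal_power1_meval; rewrite mul1r rmorphB /= mevalXU.
  have /ideal_power1_meval : mp 1 (eval2 0 0 (S k) - (p k)%:MP).
    by rewrite -(Sp k); apply: eval2_const; apply: ideal_power0.
  by rewrite rmorphB /= mevalC => /eqP; rewrite subr_eq0 => /eqP ->; rewrite subrr.
pose J : 'M[K]_3 := \matrix_(k < 3, l < 3) [:: p k; (S k)`_1`_0; (S k)`_0`_1]`_l.
pose err k := 'X_k - c * eval2 U V (S k).
(* the correction of Newton's method: inverse of the differential times error *)
pose dl l : R := \sum_k (invmx J l k)%:MP * err k.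
have hdl l : mp M.+1 (dl l) by apply: ideal_power_sum => k _; apply: ideal_powerMl; apply: H.
have Jdl k : err k = (p k)%:MP * dl ix + ((S k)`_1`_0)%:MP * dl iy + ((S k)`_0`_1)%:MP * dl iz.
  have -> : err k = \sum_l (J k l)%:MP * dl l.
    transitivity (\sum_t ((J *m invmx J) k t)%:MP * err t).
      rewrite mulmxV; last by rewrite unitmxE unitfE.
      rewrite (bigD1 k) //= big1 => [|t ne].
        by rewrite !mxE eqxx mul1r addr0.
      by rewrite !mxE eq_sym (negbTE ne) mul0r.
    under [RHS]eq_bigr => l _ do rewrite mulr_sumr.
    rewrite exchange_big; apply: eq_bigr => t _ /=.
    rewrite !mxE raddf_sum mulr_suml; apply: eq_bigr => l _ /=.
    by rewrite mpolyCM mulrA.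
  by rewrite sum3 !mxE.
have hdlS l : mp 1 (dl l) by apply: ideal_power_le (hdl l).
exists (c + dl ix), (U + dl iy), (V + dl iz); split.
- by rewrite addrAC; apply: ideal_powerD.
- exact: ideal_powerD.
- exact: ideal_powerD.
move=> k.
have hlin := eval2_linear (S k) hU hV (hdl iy) (hdl iz).
have hconst : mp 1 (eval2 (U + dl iy) (V + dl iz) (S k) - (p k)%:MP).
  by rewrite -(Sp k); apply: eval2_const; apply: ideal_powerD.
move: hlin hconst; set x' := eval2 _ _ (S k); set x := eval2 _ _ (S k).
set lin := _ * dl iy + _ => hlin hconst.
have -> : 'X_k - (c + dl ix) * x' = err k - (p k)%:MP * dl ix - lin
   - dl ix * (x' - (p k)%:MP) - c * (x' - x - lin) - (c - 1) * lin.
  by rewrite /err; ring.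
have -> : err k - (p k)%:MP * dl ix - lin = 0 by rewrite Jdl /lin; ring.
apply: ideal_powerB; last first.
  by apply: (@ideal_powerM _ _ 1 M.+1) => //; apply: ideal_powerD; apply: ideal_powerMl.
apply: ideal_powerB; last exact: ideal_powerMl.
by rewrite sub0r mulrC; apply: ideal_powerN; apply: (@ideal_powerM _ _ 1 M.+1).
Qed.

Lemma mmap_congr M (f : R) (z z' : 'I_3 -> R) :
  (forall k, mp M (z k - z' k)) ->
  mp M (mmap (@mpolyC 3 K) z f - mmap (@mpolyC 3 K) z' f).
Proof.
move=> H; elim/mpoly_closure_ind: f => [a|i|f g Hf Hg|f g Hf Hg].
- by rewrite !mmapC subrr; apply: ideal_power0.
- by rewrite !mmapX !mmap1U; apply: H.
- by rewrite !mmapD opprD addrACA; apply: ideal_powerD.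
- rewrite !rmorphM /=; move: Hf Hg; move: (mmap _ z f) (mmap _ z' f) (mmap _ z g) (mmap _ z' g).
  move=> a a' b b' Hf Hg.
  have -> : a * b - a' * b' = (a - a') * b + a' * (b - b').
    by rewrite mulrBl mulrBr addrA subrK.
  by apply: ideal_powerD; [apply: ideal_powerMr|apply: ideal_powerMl].
Qed.

End LocalParametrization.

Section Descent.
Variables (K : fieldType).
Local Notation R := {mpoly K[3]}.
Local Notation B := {poly {poly K}}.
Variables (f : 'I_3 -> R) (e : nat).
Hypothesis fhomog : forall i, f i \is e.-homog.
Variable (p : 'I_3 -> K).
Local Notation mp := (ideal_power (fun i => 'X_i - (p i)%:MP : R)).

Lemma mmap_X (h : R) : mmap (@mpolyC 3 K) (fun k => 'X_k) h = h.
Proof.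
elim/mpoly_closure_ind: h => [a|i|g h Hg Hh|g h Hg Hh].
- by rewrite mmapC.
- by rewrite mmapX mmap1U.
- by rewrite mmapD Hg Hh.
- by rewrite rmorphM /= Hg Hh.
Qed.

Lemma eval2_compose2 (U V : R) (S : 'I_3 -> B) (h : R) :
  eval2 U V (compose2 S h) = mmap (@mpolyC 3 K) (fun k => eval2 U V (S k)) h.
Proof.
elim/mpoly_closure_ind: h => [a|i|g h Hg Hh|g h Hg Hh].
- by rewrite compose2C eval2C mmapC.
- by rewrite compose2X mmapX mmap1U.
- by rewrite rmorphD [LHS]rmorphD Hg Hh mmapD.
- by rewrite rmorphM [LHS]rmorphM Hg Hh rmorphM.
Qed.

(** Substituting the approximate inverse parametrization turns the formal syzygy
    into a polynomial one up to a high power of the maximal ideal of [p]; the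
    factor [c] is harmless since the [f k] are homogeneous of the same degree. *)
Lemma approximate_syzygy M (S theta : 'I_3 -> B) :
  (forall k, (S k)`_0`_0 = p k) ->
  \det (\matrix_(k < 3, l < 3) [:: p k; (S k)`_1`_0; (S k)`_0`_1]`_l) != 0 ->
  vanish2 M (\sum_k theta k * compose2 S (f k)) ->
  exists Theta : 'I_3 -> R, (forall k, (Theta k).@[p] = (theta k)`_0`_0) /\
    mp M.+1 (dot Theta f).
Proof.
move=> Sp Sjac van.
have [c [U [V [hc hU hV HX]]]] := newton_inverse Sp Sjac M.
exists (fun k => eval2 U V (theta k)); split.
  move=> k; have /ideal_power1_meval := eval2_const (theta k) hU hV.
  by rewrite rmorphB /= mevalC => /eqP; rewrite subr_eq0 => /eqP.
pose z k := eval2 U V (S k).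
have -> : dot (fun k => eval2 U V (theta k)) f =
   \sum_k eval2 U V (theta k) * (f k - c ^+ e * mmap (@mpolyC 3 K) z (f k))
   + c ^+ e * eval2 U V (\sum_k theta k * compose2 S (f k)).
  rewrite [eval2 U V (\sum_k _)]rmorph_sum mulr_sumr -big_split; apply: eq_bigr => k _.
  by rewrite [eval2 U V (_ * _)]rmorphM eval2_compose2 mulrBr [_ ^+ _ * (_ * _)]mulrCA; apply/esym/subrK.
apply: ideal_powerD; last by apply: ideal_powerMl; apply: eval2_vanish.
apply: ideal_power_sum => k _; apply: ideal_powerMl.
rewrite -(mmap_homog _ _ _ (fhomog k)) -{1}(mmap_X (f k)).
exact: mmap_congr.
Qed.

Hypothesis felim : eliminable f.

(** The binary form in [X_k] and [X_j] becomes, in the chart [X_k = p_k], a nonzero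
    polynomial in [X_j]; its largest factor prime to [X_j - p_j] is [G]. Letting
    [j] vary, the common zeros of [f] are isolated in the chart. *)
Lemma transversal_power k j : p k != 0 -> exists N (G b : R),
  G.@[p] != 0 /\ lincomb f (('X_j - (p j)%:MP) ^+ N * G - ('X_k - (p k)%:MP) * b).
Proof.
move=> pk.
have lc0 : lincomb f 0 by exists (fun=> 0); rewrite big1 // => i _; rewrite mul0r.
have [->|jk] := eqVneq j k.
  by exists 1%N, 1, 1; rewrite expr1 meval1 oner_eq0 subrr.
have kj : k != j by rewrite eq_sym.
have [n [q [q0 sq lc]]] := felim kj.
pose q' : {poly K} := \poly_(i < n.+1) (q`_i * p k ^+ (n - i)).
have q'0 : q' != 0.
  apply: contra_neq q0 => q'0; apply/polyP => i; rewrite coef0.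
  have [hi|hi] := ltnP i n.+1; last by rewrite nth_default // (leq_trans sq).
  have := congr1 (fun r : {poly K} => r`_i) q'0; rewrite coef_poly hi coef0 => /eqP.
  by rewrite mulf_eq0 expf_eq0 (negbTE pk) andbF orbF => /eqP.
have [m [r rp eq']] := multiplicity_XsubC q' (p j).
rewrite q'0 /= in rp.
have [b Hb] := subst1_sub k (p k)%:MP (binary_form k j n q).
exists m, (eval1 'X_j r), (- b); split.
  have -> : (eval1 'X_j r).@[p] = r.[p j].
    rewrite [eval1 'X_j r](_ : _ = (map_poly (@mpolyC 3 K) r).['X_j]) //.
    rewrite (@horner_coef_wide _ (size r)) ?size_poly // rmorph_sum horner_coef.
    by apply: eq_bigr => i _; rewrite coef_map rmorphM rmorphXn /= mevalC mevalXU.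
  by rewrite -/(root r (p j)).
have -> : ('X_j - (p j)%:MP) ^+ m * eval1 'X_j r = subst1 k (p k)%:MP (binary_form k j n q).
  transitivity (eval1 'X_j q').
    by rewrite eq' rmorphM rmorphXn rmorphB eval1X eval1C mulrC.
  rewrite [eval1 'X_j q'](_ : _ = (map_poly (@mpolyC 3 K) q').['X_j]) //.
  rewrite (@horner_coef_wide _ n.+1); last first.
    by apply: leq_trans (size_poly _ _) _; apply: size_poly.
  rewrite rmorph_binary_form; apply: eq_bigr => i _.
  rewrite coef_map coef_poly ltn_ord /= mmapC !mmapX !mmap1U eqxx eq_sym (negbTE kj).
  by rewrite mpolyCM rmorphXn mulrA.
by rewrite mulrN opprK -Hb addrC subrK.
Qed.

(** The error of a syzygy that is correct to high order lies, in the chart and up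
    to a factor not vanishing at [p], in the maximal ideal times the ideal of [f]
    by [transversal_power]. It can therefore be absorbed in the coefficients
    without changing the nonvanishing of their values at [p]. *)
Lemma chart_syzygy (Theta : nat -> 'I_3 -> R) k : p k != 0 ->
  (forall M, (Theta M k).@[p] != 0) -> (forall M, mp M.+1 (dot (Theta M) f)) ->
  exists (Psi : 'I_3 -> R) (H : R),
    (Psi k).@[p] != 0 /\ dot Psi f = ('X_k - (p k)%:MP) * H.
Proof.
move=> pk Thetak ThetaM.
have HN j := cid (transversal_power j pk); pose N j := projT1 (HN j).
have HG j := cid (projT2 (HN j)); pose G j := projT1 (HG j).
have Hb j := cid (projT2 (HG j)); pose b j := projT1 (Hb j).
have HGb j : (G j).@[p] != 0 /\ lincomb f (('X_j - (p j)%:MP) ^+ N j * G j - ('X_k - (p k)%:MP) * b j).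
  exact: (projT2 (Hb j)).
have Hc j := cid (HGb j).2; pose c j := projT1 (Hc j).
have Ec j : ('X_j - (p j)%:MP) ^+ N j * G j = ('X_k - (p k)%:MP) * b j + \sum_i c j i * f i.
  by rewrite -(projT2 (Hc j)) [RHS]addrC; apply/esym/subrK.
(* at this order the error is a combination of the powers of [X_j - p_j] in
   [transversal_power], with coefficients that vanish at [p] *)
have [v [Hv Ev]] := ideal_power_splitS (ThetaM (\sum_j N j)%N).
set T := Theta _ in Ev; pose GG := \prod_j G j.
pose m j := v j * \prod_(i | i != j) G i.
have EGG : GG * dot T f = \sum_j m j * (('X_k - (p k)%:MP) * b j + \sum_i c j i * f i).
  rewrite Ev mulr_sumr; apply: eq_bigr => j _; rewrite -Ec /GG (bigD1 j) //= /m; ring.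
exists (fun i => GG * T i - \sum_j m j * c j i), (\sum_j m j * b j); split.
  have m0 j : (m j).@[p] = 0.
    by rewrite /m mevalM; have /ideal_power1_meval -> := Hv j; rewrite mul0r.
  rewrite mevalB mevalM [X in _ - X](_ : _ = 0) ?subr0; last first.
    by rewrite rmorph_sum big1 // => j _; rewrite rmorphM /= m0 mul0r.
  rewrite mulf_neq0 //; last exact: Thetak.
  rewrite /GG (big_morph _ (mevalM p) (meval1 p)); apply/prodf_neq0 => j _.
  by case: (HGb j).
have -> : dot (fun i => GG * T i - \sum_j m j * c j i) f =
   GG * dot T f - \sum_j m j * \sum_i c j i * f i.
  rewrite /dot; under eq_bigr => i _ do rewrite mulrBl -mulrA mulr_suml.
  rewrite sumrB -mulr_sumr exchange_big; congr (_ - _); apply: eq_bigr => j _ /=.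
  by rewrite mulr_sumr; apply: eq_bigr => i _; rewrite mulrA.
rewrite EGG; under eq_bigr => j _ do rewrite mulrDr.
by rewrite big_split addrK mulr_sumr; apply: eq_bigr => j _; rewrite mulrCA.
Qed.

(** Homogenize with respect to [X_k / p_k]: this is 1 on the chart, so values at
    [p] only change by a nonzero factor. *)
Lemma homogenized_syzygy (Psi : 'I_3 -> R) H k : p k != 0 ->
  dot Psi f = ('X_k - (p k)%:MP) * H ->
  exists A : 'I_3 -> R, dot A f = 0 /\
    forall i, exists2 c, c != 0 & (A i).@[p] = c * (Psi i).@[p].
Proof.
move=> pk E.
have [L [L_gt0 LH LPsi]] : exists L, [/\ (0 < L)%N, (msize H <= L.-1)%N
    & forall i, (msize (Psi i) <= L)%N].
  exists (msize H + msize (Psi ix) + msize (Psi iy) + msize (Psi iz)).+1.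
  by split=> [||i] //; [|elim/ord3_ind: i]; lia.
pose D n := homog_part n (dot Psi f).
pose w (n : nat) : R := (p k ^+ n)%:MP * 'X_k ^+ (e + L - n).
pose A i := \sum_(n < (e + L)) w n * (if (e <= n)%N then homog_part (n - e) (Psi i) else 0).
have DA n : D n = dot (fun i => if (e <= n)%N then homog_part (n - e) (Psi i) else 0) f.
  exact: homog_part_sumM.
have D0 : D 0%N = - (p k)%:MP * homog_part 0 H.
  rewrite /D E mulrBl raddfB /= -['X_k]expr1 (homog_partM _ _ (homogXn _ _ _)) /= sub0r.
  by rewrite mul_mpolyC linearZ /= mulNr mul_mpolyC.
have DS n : D n.+1 = 'X_k * homog_part n H - (p k)%:MP * homog_part n.+1 H.
  rewrite /D E mulrBl raddfB /= -['X_k]expr1 (homog_partM _ _ (homogXn _ _ _)) /= subn1 /=.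
  by rewrite !mul_mpolyC linearZ.
(* the components of [(X_k - p_k) H] are [X_k H_(n-1) - p_k H_n] *)
have telescope m : (m < e + L)%N -> \sum_(n < m.+1) w n * D n =
    - ((p k ^+ m.+1)%:MP * 'X_k ^+ (e + L - m) * homog_part m H).
  elim: m => [|m IH] hm.
    by rewrite big_ord1 /w D0 subn0 expr0 mpolyC1 mul1r expr1 !mulNr mulrN mulrCA mulrA.
  rewrite big_ord_recr /= IH; last exact: ltnW.
  have -> : 'X_k ^+ (e + L - m) = 'X_k * 'X_k ^+ (e + L - m.+1) :> R.
    by rewrite -exprS subnSK // ltnW.
  rewrite /w DS [p k ^+ m.+2]exprS mpolyCM.
  by move: ('X_k ^+ (e + L - m.+1)) ((p k ^+ m.+1)%:MP) => X c; ring.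
exists A; split.
  have -> : dot A f = \sum_(n < (e + L)) w n * D n.
    under [RHS]eq_bigr => n _ do rewrite DA.
    rewrite /dot /A; under [LHS]eq_bigr => i _ do rewrite mulr_suml.
    rewrite exchange_big; apply: eq_bigr => n _ /=.
    by rewrite mulr_sumr; apply: eq_bigr => i _; rewrite mulrA.
  have eL : (e + L = (e + L.-1).+1)%N by rewrite -addnS prednK.
  have lt_eL : (e + L.-1 < e + L)%N by rewrite eL.
  have := telescope _ lt_eL; rewrite -eL => ->.
  by rewrite homog_part_large ?mulr0 ?oppr0 // (leq_trans LH) ?leq_addl.
move=> i; exists (p k ^+ (e + L)); first by rewrite expf_neq0.
have -> : (Psi i).@[p] = \sum_(n < L) (homog_part n (Psi i)).@[p].
  rewrite {1}[Psi i]homog_part_sum !raddf_sum /=.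
  have hL := LPsi i.
  rewrite (big_ord_widen L (fun n => (homog_part n (Psi i)).@[p])) // big_mkcond /=.
  apply: eq_bigr => n _; case: ltnP => // hn.
  by rewrite homog_part_large // meval0.
rewrite /A raddf_sum big_split_ord /= big1 ?add0r => [|n _]; last first.
  by rewrite leqNgt ltn_ord /= mulr0 meval0.
rewrite mulr_sumr; apply: eq_bigr => n _.
have XN N : ('X_k ^+ N : R).@[p] = p k ^+ N by rewrite rmorphXn /= mevalXU.
by rewrite leq_addr addKn /w !mevalM mevalC XN -exprD subnKC // leq_add2l ltnW.
Qed.

End Descent.

Section QuasihomogeneousSyzygy.
Variables (R0 : realType).
Local Notation K := R0[i].
Local Notation R := {mpoly K[3]}.
Variables (F : R) (d : nat).
Hypotheses (Fhomog : F \is d.-homog) (d_gt0 : (0 < d)%N).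
Let f i := F^`M(i).
Hypothesis felim : eliminable f.

(** The formal syzygy is successively made polynomial up to a high order, exact in
    the chart, and exact. That its value at the point is nonzero means that two
    germs suffice to generate the Jacobian ideal there; this is where
    quasihomogeneity enters. *)
Lemma quasihomogeneous_syzygy p : singular_point F p -> quasihomogeneous_at F p ->
  exists A : 'I_3 -> R, dot A f = 0 /\ exists i, (A i).@[p] != 0.
Proof.
move=> [[k pk] psing] [s [e [g [sp sjac [_ e0] gw Fseg]]]].
have sp' i : s i 0%N 0%N = p i by have [_ ->] := sp i.
have fhomog i : f i \is d.-1.-homog by apply: mderiv_homog.
have HT M : exists Theta : 'I_3 -> R, (Theta k).@[p] != 0 /\
    ideal_power (fun i => 'X_i - (p i)%:MP : R) M.+1 (dot Theta f).
  have [S [theta [c [c0 HS Htheta van]]]] :=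
    formal_syzygy Fhomog d_gt0 psing sp' e0 gw Fseg M.+1.
  have Sp i : (S i)`_0`_0 = p i by rewrite HS.
  have Sjac : \det (\matrix_(k < 3, l < 3) [:: p k; (S k)`_1`_0; (S k)`_0`_1]`_l) != 0.
    congr (\det _ != 0): sjac; apply/matrixP => i j; rewrite !mxE.
    by rewrite sp' !HS.
  have [Theta [HT HM]] := approximate_syzygy fhomog Sp Sjac van.
  by exists Theta; split; [rewrite HT Htheta mulf_neq0|apply: ideal_powerS].
have Hsing := choice HT.
have [Psi [H [Psik EPsi]]] := chart_syzygy felim pk
  (fun M => (projT2 Hsing M).1) (fun M => (projT2 Hsing M).2).
have [A [Af HA]] := homogenized_syzygy fhomog pk EPsi.
exists A; split=> //; exists k.
by have [c c0 ->] := HA k; rewrite mulf_neq0.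
Qed.
End QuasihomogeneousSyzygy.

(** * Free modules and linear algebra at the origin *)

Section CommonFamily.
Variables (S : nzRingType) (M : lmodType S) (B : set M).

Lemma common_injective_family (I : finType) (t : I -> M) :
  (forall i, exists n (b : 'I_n -> M) (a : 'I_n -> S),
     (forall k, B (b k)) /\ t i = \sum_k a k *: b k) ->
  exists n (b : 'I_n -> M) (X : I -> 'I_n -> S),
    [/\ injective b, forall j, B (b j) & forall i, t i = \sum_j X i j *: b j].
Proof.
move=> H.
pose n i := projT1 (cid (H i)).
have H1 i := cid (projT2 (cid (H i))); pose bb i : 'I_(n i) -> M := projT1 (H1 i).
have H2 i := cid (projT2 (H1 i)); pose aa i : 'I_(n i) -> S := projT1 (H2 i).
have [HB HE] : (forall i k, B (bb i k)) /\ (forall i, t i = \sum_k aa i k *: bb i k).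
  by split=> i; case: (projT2 (H2 i)).
pose L := undup (flatten [seq [seq bb i k | k <- enum 'I_(n i)] | i <- enum I]).
have memL i k : bb i k \in L.
  rewrite mem_undup; apply/flattenP; exists [seq bb i k | k <- enum 'I_(n i)].
    by apply/mapP; exists i; rewrite ?mem_enum.
  by apply/mapP; exists k; rewrite ?mem_enum.
exists (size L), (tnth (in_tuple L)),
  (fun i j => \sum_(k | bb i k == tnth (in_tuple L) j) aa i k); split.
- by apply/tuple_uniqP; apply: undup_uniq.
- move=> j; have := mem_tnth j (in_tuple L).
  rewrite mem_undup => /flattenP [_ /mapP [i _ ->] /mapP [k _ ->]]; exact: HB.
- move=> i; rewrite HE.
  under [RHS]eq_bigr => j _ do rewrite scaler_suml.
  rewrite (exchange_big_dep predT) //=; apply: eq_bigr => k _.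
  have [j Hj] : exists j, bb i k = tnth (in_tuple L) j.
    by have /tnthP [j ->] : bb i k \in in_tuple L := memL i k; exists j.
  rewrite (bigD1 j) /=; last by rewrite Hj.
  rewrite -Hj big1 ?addr0 // => j' /andP[/eqP e ne].
  have /tuple_uniqP uL : uniq (in_tuple L) by apply: undup_uniq.
  by case/eqP: ne; apply: uL; rewrite -e -Hj.
Qed.
End CommonFamily.

(** Let three elements [t] of a free module be independent modulo the maximal
    ideal of the origin. Their coordinate matrix has rank three at the origin, so
    after multiplication by a constant matrix [C] it becomes a square matrix whose
    determinant is nonzero at the origin. This gives independence, and Cramer's
    rule shows that whatever is generically a combination of the [t] is so up to
    a factor that is nonzero at the origin. *)
Section LocalBasis.
Variables (K : fieldType) (m : nat).
Local Notation S := {mpoly K[m]}.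
Variables (M : lmodType S) (D : set M).
Hypothesis Dfree : free_submodule D.
Hypothesis torsion_free : forall (c : S) (v : M), c != 0 -> c *: v = 0 -> v = 0.
Let ev0 (h : S) : K := h.@[fun=> 0].
Variable t : 'I_3 -> M.
Hypothesis Dt : forall i, D (t i).
Hypothesis tindep : forall (kap : 'I_3 -> K) n (y : 'I_n -> S) (b : 'I_n -> M),
  (forall j, ev0 (y j) = 0) -> (forall j, D (b j)) ->
  \sum_i (kap i)%:MP *: t i = \sum_j y j *: b j -> forall i, kap i = 0.

Lemma local_coordinates (w : M) : D w -> exists n (b : 'I_n -> M) (T : 'M[S]_(3, n))
    (r : 'rV[S]_n) (C : 'M[S]_(n, 3)),
  [/\ forall c : 'rV[S]_n, \sum_j c 0 j *: b j = 0 -> c = 0,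
      forall i, t i = \sum_j T i j *: b j, w = \sum_j r 0 j *: b j
    & ev0 (\det (T *m C)) = 1].
Proof.
move=> Dw; have [B [BD Bspan Bindep]] := Dfree.
pose tt (o : option 'I_3) := if o is Some i then t i else w.
have [|n [b [X [binj Bb HX]]]] := @common_injective_family _ _ B _ tt.
  by move=> o; apply: Bspan; case: o.
pose T : 'M[S]_(3, n) := \matrix_(i, j) X (Some i) j.
pose T0 := map_mx ev0 T.
have freeT0 : row_free T0.
  apply: inj_row_free => v vT; apply/rowP => i; rewrite mxE.
  move: i; apply: (tindep (n := n) (y := fun j => \sum_i (v 0 i)%:MP * T i j) (b := b)).
  - move=> j; have := congr1 (fun u : 'rV_n => u 0 j) vT; rewrite !mxE => <-.
    rewrite /ev0 (big_morph _ (mevalD _) (meval0 _)).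
    by apply: eq_bigr => i _; rewrite mevalM mevalC !mxE.
  - by move=> j; apply: BD.
  under [RHS]eq_bigr => j _ do rewrite scaler_suml.
  rewrite exchange_big; apply: eq_bigr => i _ /=.
  rewrite [t i](HX (Some i)) scaler_sumr; apply: eq_bigr => j _.
  by rewrite scalerA mxE.
exists n, b, T, (\row_j X None j), (map_mx (@mpolyC m K) (pinvmx T0)); split.
- move=> c c0; apply/rowP => j; rewrite mxE.
  exact: (Bindep n b (fun j => c 0 j) binj Bb c0).
- by move=> i; rewrite [LHS](HX (Some i)); apply: eq_bigr => j _; rewrite mxE.
- by rewrite [LHS](HX None); apply: eq_bigr => j _; rewrite mxE.
rewrite /ev0 -det_map_mx map_mxM -map_mx_comp.
rewrite (_ : map_mx _ (pinvmx T0) = pinvmx T0); last first.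
  by apply/matrixP => i j; rewrite mxE /= mevalC.
by rewrite mulmxVp // det1.
Qed.

Lemma local_independent (x : 'I_3 -> S) : \sum_i x i *: t i = 0 -> forall i, x i = 0.
Proof.
move=> x0; have [n [b [T [r [C [bindep HT _ dT]]]]]] := local_coordinates (Dt ix).
pose xr : 'rV[S]_3 := \row_i x i.
have xT : xr *m T = 0.
  apply: bindep; rewrite -[RHS]x0.
  under eq_bigr => j _ do rewrite mxE scaler_suml.
  rewrite exchange_big; apply: eq_bigr => i _ /=.
  by rewrite HT scaler_sumr; apply: eq_bigr => j _; rewrite scalerA mxE.
have : \det (T *m C) *: xr = 0.
  by rewrite -mul_mx_scalar -mul_mx_adj mulmxA mulmxA xT !mul0mx.
have d0 : \det (T *m C) != 0.
  by apply/eqP => d0; move: dT; rewrite d0 /ev0 meval0 => /esym/eqP; rewrite oner_eq0.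
move=> dx i; have := congr1 (fun u : 'rV_3 => u 0 i) dx; rewrite !mxE => /eqP.
by rewrite mulf_eq0 (negbTE d0) => /eqP.
Qed.

Lemma local_generation (w : M) (Del : S) (y : 'I_3 -> S) : D w -> Del != 0 ->
  Del *: w = \sum_i y i *: t i ->
  exists (del : S) (Y : 'I_3 -> S), ev0 del = 1 /\ del *: w = \sum_i Y i *: t i.
Proof.
move=> Dw Del0 ew; have [n [b [T [r [C [bindep HT Hr dT]]]]]] := local_coordinates Dw.
pose yr : 'rV[S]_3 := \row_i y i.
have eT : Del *: r = yr *m T.
  apply/eqP; rewrite -subr_eq0; apply/eqP; apply: bindep.
  under eq_bigr => j _ do rewrite !mxE scalerBl.
  rewrite sumrB.
  have -> : \sum_j (Del * r 0 j) *: b j = Del *: w.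
    by rewrite Hr scaler_sumr; apply: eq_bigr => j _; rewrite scalerA.
  rewrite ew; apply/eqP; rewrite subr_eq0; apply/eqP.
  under [RHS]eq_bigr => j _ do rewrite scaler_suml.
  rewrite [RHS]exchange_big; apply: eq_bigr => i _ /=.
  by rewrite HT scaler_sumr; apply: eq_bigr => j _; rewrite scalerA mxE.
pose del := \det (T *m C); pose Y : 'rV[S]_3 := r *m C *m \adj (T *m C).
have eY : del *: yr = Del *: Y.
  by rewrite /Y scalemxAl scalemxAl eT -mul_mx_scalar -mul_mx_adj -!mulmxA.
exists del, (fun i => Y 0 i); split=> //.
apply/eqP; rewrite -subr_eq0; apply/eqP; apply: (torsion_free Del0).
rewrite scalerBr scalerA mulrC -scalerA ew !scaler_sumr -sumrB big1 // => i _.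
rewrite !scalerA; have := congr1 (fun u : 'rV_3 => u 0 i) eY; rewrite !mxE => ->.
by rewrite subrr.
Qed.
End LocalBasis.

(** * A homogeneous basis of the syzygies of a free curve *)

Section HomogeneousBasis.
Variables (K : numClosedFieldType).
Local Notation R := {mpoly K[3]}.
Variables (F : R) (d : nat).
Hypotheses (Fhomog : F \is d.-homog) (d_gt0 : (0 < d)%N) (F0 : F != 0).
Let f i := F^`M(i).
Hypothesis felim : eliminable f.
Hypothesis Ffree : free_curve F.

Definition homog_syzygy n (v : 'I_3 -> R) := (forall i, v i \is n.-homog) /\ dot v f = 0.

Let fhomog i : f i \is d.-1.-homog.
Proof. exact: mderiv_homog. Qed.

Let dK : d%:R != 0 :> K.
Proof. by rewrite pnatr_eq0 -lt0n. Qed.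

Lemma syzygy_homog_part n v : dot v f = 0 -> homog_syzygy n (fun i => homog_part n (v i)).
Proof.
move=> vf; split=> [i|]; first exact: homog_partP.
have := homog_part_sumM fhomog v (n + d.-1); rewrite -/(dot v f) vf raddf0 => ->.
by apply: eq_bigr => i _; rewrite leq_addl addnK.
Qed.

Definition koszul (j i : 'I_3) : R := cross f (fun l => (l == j)%:R) i.

Lemma koszul_syzygy j : homog_syzygy d.-1 (koszul j).
Proof.
split; last by rewrite dotC dot_cross_left.
elim/ord3_ind; elim/ord3_ind: j; rewrite /koszul /cross /= ?mulr0 ?mulr1 ?subr0 ?sub0r ?rpredN //;
  by rewrite ?rpred0.
Qed.

(** The cross products of the Koszul syzygies are multiples of [f] by its own
    entries, whereas multiples of one vector have zero cross product. *)
Lemma not_all_multiples (a : 'I_3 -> R) :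
  exists j, forall x, ~ (forall i, koszul j i = x * a i).
Proof.
apply: contrapT => /forallNP H.
have {}H j : exists x, forall i, koszul j i = x * a i.
  by have /existsNP [x /contrapT Hx] := H j; exists x.
have [t ft] := eliminable_neq0 felim.
have crossk j l : cross (koszul j) (koszul l) t = 0.
  have [x Hx] := H j; have [x' Hx'] := H l.
  elim/ord3_ind: (t); rewrite /cross /= !Hx !Hx'; ring.
have := crossk ix iy; have := crossk iy iz; have := crossk iz ix.
have h j l r : cross (koszul j) (koszul l) t = f r * f t -> f r * f t = 0 by move=> <-.
have : f t * f t = 0.
  elim/ord3_ind: (t) crossk => crossk.
  - by rewrite -[RHS](crossk iy iz) /cross /koszul /cross /=; ring.
  - by rewrite -[RHS](crossk iz ix) /cross /koszul /cross /=; ring.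
  - by rewrite -[RHS](crossk ix iy) /cross /koszul /cross /=; ring.
by move=> /eqP; rewrite mulf_eq0 (negbTE ft).
Qed.

(** The minimality of both degrees is what makes the Euler derivation, [a] and [u]
    independent modulo the maximal ideal of the origin. *)
Lemma homogeneous_pair : exists r s (a u : 'I_3 -> R),
  [/\ homog_syzygy r a /\ homog_syzygy s u,
      forall n v, (n < r)%N -> homog_syzygy n v -> forall i, v i = 0,
      exists i, a i != 0,
      forall n v, (n < s)%N -> homog_syzygy n v -> exists x, forall i, v i = x * a i
    & forall x, ~ (forall i, u i = x * a i)].
Proof.
pose P n := `[< exists v, homog_syzygy n v /\ exists i, v i != 0 >].
have exP : exists n, P n.
  have [j Hj] := not_all_multiples (fun=> 0).
  exists d.-1; apply/asboolP; exists (koszul j); split; first exact: koszul_syzygy.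
  apply: contrapT => /forallNP H; apply: (Hj 0) => i; rewrite mul0r.
  by have /negP := H i; rewrite negbK => /eqP.
case: (ex_minnP exP) => r /asboolP [a [asyz [ia aia]]] rmin.
pose Q n := `[< exists v, homog_syzygy n v /\ forall x, ~ (forall i, v i = x * a i) >].
have exQ : exists n, Q n.
  have [j Hj] := not_all_multiples a.
  by exists d.-1; apply/asboolP; exists (koszul j); split=> //; apply: koszul_syzygy.
case: (ex_minnP exQ) => s /asboolP [u [usyz umul]] smin.
exists r, s, a, u; split=> //; last 1 first.
- move=> n v ns vsyz; apply: contrapT => /forallNP H.
  by move: ns; rewrite ltnNge smin //; apply/asboolP; exists v.
- move=> n v nr vsyz i; apply/eqP; apply: contraLR nr => vi.
  by rewrite -leqNgt; apply: rmin; apply/asboolP; exists v; split=> //; exists i.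
- by exists ia.
Qed.

(** Coefficients without constant term raise the degree, so in degree [n] only
    syzygies of degree less than [n] contribute. *)
Lemma low_degree_comp n (a : 'I_3 -> R) J (y : 'I_J -> R) (m : 'I_J -> 'I_3 -> R) :
  (forall k v, (k < n)%N -> homog_syzygy k v -> exists x, forall i, v i = x * a i) ->
  (forall j, (y j).@[fun=> 0] = 0) -> (forall j, dot (m j) f = 0) ->
  exists x, forall i, homog_part n (\sum_j y j * m j i) = x * a i.
Proof.
move=> low y0 mf.
have H j k : exists x, forall i, homog_part n (homog_part k (y j) * m j i) = x * a i.
  have [k0|k_gt0] := posnP k.
    exists 0 => i; rewrite mul0r k0 (_ : homog_part 0 (y j) = 0) ?mul0r ?raddf0 //.
    by rewrite homog_part0E y0 mpolyC0.
  have [kn|nk] := leqP k n; last first.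
    by exists 0 => i; rewrite (homog_partM _ _ (homog_partP _ _)) leqNgt nk mul0r.
  have [||x Hx] := low (n - k)%N (fun i => homog_part (n - k) (m j i)).
  - by rewrite ltn_subrL k_gt0 (leq_trans k_gt0).
  - exact: syzygy_homog_part.
  exists (homog_part k (y j) * x) => i.
  by rewrite (homog_partM _ _ (homog_partP _ _)) kn Hx mulrA.
exists (\sum_j \sum_(k < msize (y j)) projT1 (cid (H j k))) => i.
rewrite raddf_sum mulr_suml; apply: eq_bigr => j _ /=.
rewrite {1}[y j]homog_part_sum mulr_suml raddf_sum mulr_suml; apply: eq_bigr => k _ /=.
exact: (projT2 (cid (H j k))).
Qed.

Let E (i : 'I_3) : R := 'X_i.

Let dotE_E : dot E f = d%:R *: F.
Proof. exact: dot_euler. Qed.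

Lemma der_inj (v w : 'I_3 -> R) : der v = der w -> v = w.
Proof. by move=> e; apply: funext => i; rewrite -(der_X v) e der_X. Qed.

Lemma log_der (v : 'I_3 -> R) : (exists g, dot v f = g * F) -> log_derivations F (der v).
Proof.
move=> H; apply/log_derivationsP; split; first exact: der_derivation.
by rewrite (_ : (fun i => der v 'X_i) = v) //; apply: funext => i; rewrite der_X.
Qed.

Lemma fun_torsion_free (c : R) (v : R -> R^o) : c != 0 -> c *: v = 0 -> v = 0.
Proof.
move=> c0 e; apply: funext => x; have /eqP := congr1 (fun g => g x) e.
by rewrite [X in X == _ -> _](_ : _ = c * v x) // mulf_eq0 (negbTE c0) => /eqP.
Qed.

(** The Euler derivation, [a] and [u] are independent modulo the maximal ideal by
    minimality of the degrees, so [local_independent] and [local_generation] apply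
    to the logarithmic derivations. A homogeneous syzygy [v] is generically a
    combination of these three elements, hence [del v] is one for some [del] with
    constant term 1, and the components of the degree of [v] express [v] itself.
    Finally [a x u] is a multiple [be f] of [f], and [be] is invertible because
    the cross products of the Koszul syzygies are the multiples of [f] by its
    entries. *)
Lemma homogeneous_basis : exists r s (a u : 'I_3 -> R),
  [/\ homog_syzygy r a, homog_syzygy s u, (r <= s)%N,
      exists eps, forall i, f i = eps * cross a u i
    & forall v, dot v f = 0 -> exists x y, forall i, v i = x * a i + y * u i].
Proof.
have [r [s [a [u [[asyz usyz] rmin [ia aia] smin umul]]]]] := homogeneous_pair.
have [ahom af] := asyz; have [uhom uf] := usyz.
have rs : (r <= s)%N.
  rewrite leqNgt; apply/negP => sr; apply: (umul 0) => i.
  by rewrite mul0r; apply: (rmin s).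
pose tv (j : 'I_3) : 'I_3 -> R := if j == ix then E else if j == iy then a else u.
pose t j : R -> R^o := der (tv j).
have Dt j : log_derivations F (t j).
  apply: log_der; elim/ord3_ind: j; rewrite /tv /=.
  - by exists d%:R%:MP; rewrite dotE_E mul_mpolyC.
  - by exists 0; rewrite af mul0r.
  - by exists 0; rewrite uf mul0r.
have tindep (kap : 'I_3 -> K) n (y : 'I_n -> R) (b : 'I_n -> R -> R^o) :
    (forall j, (y j).@[fun=> 0] = 0) -> (forall j, log_derivations F (b j)) ->
    \sum_i (kap i)%:MP *: t i = \sum_j y j *: b j -> forall i, kap i = 0.
  move=> y0 Db e.
  have Hb j := (log_derivationsP F (b j)).1 (Db j).
  pose be j i : R := b j 'X_i.
  have bE j : b j = der (be j) by apply: derivationE; case: (Hb j).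
  have Hg j : exists g, dot (be j) f = g * F by case: (Hb j).
  pose g j := projT1 (cid (Hg j)).
  have gE j : dot (be j) f = g j * F := projT2 (cid (Hg j)).
  have ev i : (kap ix)%:MP * E i + (kap iy)%:MP * a i + (kap iz)%:MP * u i =
      \sum_j y j * be j i.
    move: e; under [RHS]eq_bigr => j _ do rewrite bE.
    rewrite !der_comb => /der_inj /(congr1 (fun h => h i)) <-.
    by rewrite sum3.
  have gsum : (kap ix * d%:R)%:MP = \sum_j y j * g j.
    apply: (mulIf F0).
    transitivity (dot (fun i => (kap ix)%:MP * E i + (kap iy)%:MP * a i + (kap iz)%:MP * u i) f).
      transitivity ((kap ix)%:MP * dot E f + (kap iy)%:MP * dot a f + (kap iz)%:MP * dot u f).
        by rewrite af uf !mulr0 !addr0 dotE_E -mul_mpolyC mpolyCM mulrA.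
      by rewrite !dotE; ring.
    rewrite /dot; under eq_bigr => i _ do rewrite ev mulr_suml.
    rewrite exchange_big mulr_suml; apply: eq_bigr => j _ /=.
    by rewrite -mulrA -gE mulr_sumr; apply: eq_bigr => i _; rewrite mulrA.
  have k0 : kap ix = 0.
    have /eqP := congr1 (meval (fun=> 0)) gsum.
    rewrite mevalC (big_morph _ (mevalD _) (meval0 _)) big1 => [|j _].
      by rewrite mulf_eq0 (negbTE dK) orbF => /eqP.
    by rewrite mevalM y0 mul0r.
  pose m j i := be j i - (d%:R^-1 *: g j) * E i.
  have mf j : dot (m j) f = 0.
    transitivity (dot (be j) f - (d%:R^-1 *: g j) * dot E f); first by rewrite !dotE /m; ring.
    by rewrite gE dotE_E -scalerAl -scalerAr scalerA mulVf // scale1r subrr.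
  have em i : (kap iy)%:MP * a i + (kap iz)%:MP * u i = \sum_j y j * m j i.
    under eq_bigr => j _ do rewrite /m mulrBr mulrA -scalerAr.
    rewrite sumrB -mulr_suml -scaler_sumr -gsum k0 mul0r mpolyC0 scaler0 mul0r subr0 -ev.
    by rewrite k0 mpolyC0 mul0r add0r.
  have k2 : kap iz = 0.
    have [x Hx] := low_degree_comp smin y0 mf.
    apply/eqP; apply: contraT => k2; exfalso.
    have [c Hc] : exists c, forall i, homog_part s (a i) = c * a i.
      have [e0|ne] := eqVneq r s; first by exists 1 => i; rewrite mul1r homog_part_id // -e0.
      by exists 0 => i; rewrite mul0r (homog_part_ne (ahom i) ne).
    have e1 i : kap iy *: (c * a i) + kap iz *: u i = x * a i.
      by rewrite -Hx -em !mul_mpolyC raddfD /= !linearZ /= Hc (homog_part_id (uhom i)).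
    apply: (umul ((kap iz)^-1 *: (x - (kap iy)%:MP * c))) => i.
    have e2 : (x - (kap iy)%:MP * c) * a i = kap iz *: u i.
      by rewrite mulrBl -e1 -mulrA mul_mpolyC addrAC subrr add0r.
    by rewrite -[RHS]scalerAl e2 scalerA mulVf // scale1r.
  have k1 : kap iy = 0.
    have low0 k v : (k < r)%N -> homog_syzygy k v -> exists x : R, forall i, v i = x * (fun=> 0) i.
      by move=> kr vs; exists 0 => i; rewrite mul0r (rmin k).
    have [x Hx] := low_degree_comp low0 y0 mf.
    have := Hx ia; rewrite -em k2 mpolyC0 mul0r addr0 mulr0 mul_mpolyC linearZ /=.
    by rewrite (homog_part_id (ahom ia)) => /eqP; rewrite scaler_eq0 (negbTE aia) orbF => /eqP.
  exact: ord3_ind.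
(* hence [a x u] is not zero *)
have indep := local_independent Ffree Dt tindep.
have [be Hbe] := orthogonal_cross felim uf af.
have be0 : be != 0.
  apply/eqP => be0.
  have par := @cross0_parallel _ a u (fun i => etrans (Hbe i) (etrans (congr1 (fun h => h * f i) be0) (mul0r _))).
  pose x (j : 'I_3) : R := if j == ix then 0 else if j == iy then u ia else - a ia.
  suff /indep /(_ iz) /eqP : \sum_i x i *: t i = 0.
    by rewrite /x /= oppr_eq0 (negbTE aia).
  rewrite der_comb; apply: funext => q; rewrite /der big1 // => i _.
  by rewrite sum3 /x /tv /= mul0r add0r (par ia i) mulNr mulrC [X in _ - X]mulrC subrr mulr0.
pose Del := dot E (cross a u).
have DelE : Del = be * (d%:R *: F).
  rewrite -dotE_E /Del /dot mulr_sumr; apply: eq_bigr => i _.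
  by rewrite Hbe mulrCA.
have Del0 : Del != 0.
  by rewrite DelE mulf_neq0 // scaler_eq0 (negbTE dK) (negbTE F0).
have spanh n v : homog_syzygy n v -> exists x y, forall i, v i = x * a i + y * u i.
  move=> [vhom vf].
  pose y (j : 'I_3) : R := if j == ix then dot v (cross a u) else
    if j == iy then dot E (cross v u) else dot E (cross a v).
  have Dv : log_derivations F (der v) by apply: log_der; exists 0; rewrite vf mul0r.
  (* Cramer's rule for the determinant [Del] of the Euler vector, [a] and [u] *)
  have eDel : Del *: (der v : R -> R^o) = \sum_i y i *: t i.
    have := der_comb (fun _ : 'I_1 => Del) (fun=> v); rewrite !big_ord1 => ->.
    rewrite der_comb; congr der; apply: funext => i; rewrite big_ord1 sum3 /y /tv /= /Del !dotE.
    by elim/ord3_ind: i; rewrite /cross /=; ring.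
  have [del [Y [del0 eY]]] := local_generation Ffree fun_torsion_free Dt tindep Dv Del0 eDel.
  have {}eY i : del * v i = Y ix * E i + Y iy * a i + Y iz * u i.
    move: eY; have := der_comb (fun _ : 'I_1 => del) (fun=> v); rewrite !big_ord1 => ->.
    rewrite der_comb => /der_inj /(congr1 (fun h => h i)); rewrite big_ord1 => ->.
    by rewrite sum3.
  have Y0 : Y ix = 0.
    have : del * dot v f = Y ix * dot E f + Y iy * dot a f + Y iz * dot u f.
      rewrite !dotE !mulrDr !mulrA !eY; ring.
    rewrite vf af uf !mulr0 !addr0 dotE_E => /esym/eqP.
    by rewrite mulf_eq0 scaler_eq0 (negbTE dK) (negbTE F0) !orbF => /eqP.
  have hdel : homog_part 0 del = 1 by rewrite homog_part0E del0.
  exists (if (r <= n)%N then homog_part (n - r) (Y iy) else 0),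
         (if (s <= n)%N then homog_part (n - s) (Y iz) else 0) => i.
  have := congr1 (homog_part n) (eY i).
  rewrite Y0 mul0r add0r mulrC [Y iy * _]mulrC [Y iz * _]mulrC raddfD /=.
  rewrite (homog_partM _ _ (vhom i)) (homog_partM _ _ (ahom i)) (homog_partM _ _ (uhom i)).
  rewrite leqnn subnn hdel mulr1 => ->.
  by congr (_ + _); case: ifP => _; rewrite ?mul0r // mulrC.
have span v : dot v f = 0 -> exists x y, forall i, v i = x * a i + y * u i.
  move=> vf.
  have H n := cid (spanh _ _ (syzygy_homog_part n vf)); pose xx n := projT1 (H n).
  have H' n := cid (projT2 (H n)); pose yy n := projT1 (H' n).
  have Hn n i : homog_part n (v i) = xx n * a i + yy n * u i := projT2 (H' n) i.
  have [L HL] : exists L, forall i, (msize (v i) <= L)%N.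
    exists (msize (v ix) + msize (v iy) + msize (v iz))%N.
    by elim/ord3_ind; lia.
  exists (\sum_(n < L) xx n), (\sum_(n < L) yy n) => i.
  rewrite !mulr_suml -big_split /= -[LHS](homog_part_sum_le (HL i)).
  by apply: eq_bigr => n _; rewrite Hn.
exists r, s, a, u; split=> //.
have comb v w : dot v f = 0 -> dot w f = 0 -> exists ga, forall i, cross v w i = ga * cross a u i.
  move=> /span [x [y Hv]] /span [x' [y' Hw]]; exists (x * y' - y * x').
  by elim/ord3_ind; rewrite /cross /= !Hv !Hw; ring.
have [t0 ft0] := eliminable_neq0 felim.
have Hga k : exists ga, f k = ga * be.
  (* the two Koszul syzygies whose cross product is [f k] times [f] *)
  pose k1 := (if k == ix then iy else if k == iy then iz else ix).
  pose k2 := (if k == ix then iz else if k == iy then ix else iy).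
  have [ga Hga] := comb _ _ (koszul_syzygy k1).2 (koszul_syzygy k2).2.
  exists ga; apply: (mulIf ft0); rewrite -mulrA -Hbe -Hga.
  by rewrite /k1 /k2; elim/ord3_ind: (t0); elim/ord3_ind: (k); rewrite /cross /koszul /cross /=; ring.
pose ga k := projT1 (cid (Hga k)).
have gaE k : f k = ga k * be := projT2 (cid (Hga k)).
have [eps Heps] : exists eps, forall i, ga i = eps * f i.
  apply: (parallel_multiple felim) => i j; apply: (mulIf be0).
  by rewrite mulrAC -gaE [RHS]mulrAC -gaE mulrC.
by exists eps => i; rewrite Hbe mulrCA -Heps mulrC -gaE.
Qed.
End HomogeneousBasis.

(** * The theorem *)

Section JacobianIdeal.
Variables (K : numClosedFieldType).
Local Notation R := {mpoly K[3]}.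
Variables (F : R) (d : nat).
Hypothesis Fhomog : F \is d.-homog.
Hypothesis Fheight : ideal_height (jacobian_ideal F) 2.
Let f i := F^`M(i).

Lemma jacobian_idealP g : jacobian_ideal F g <-> lincomb f g.
Proof. exact: (ideal_gen3P f g). Qed.

Lemma jacobian_proper : ~ lincomb f 1.
Proof.
move=> J1; have [_ [P [Pprime PJ _]]] := Fheight.
by have := prime_ideal1 Pprime; rewrite PJ //; apply/jacobian_idealP.
Qed.

Lemma jacobian_eliminable : eliminable f.
Proof.
move=> k j kj; have [l [kl jl]] := ord3_third kj.
apply: (binary_form_in_height2_ideal kj kl jl (e := d.-1)) => [i|Q Qprime Qf].
  exact: mderiv_homog.
apply: (Fheight.1 Q Qprime) => p /jacobian_idealP [c ->].
apply: (big_ind (fun x => x \in Q)) => [|x y Qx Qy|i _].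
- exact: prime_ideal0.
- exact: prime_idealD.
- by apply: prime_idealMl.
Qed.

Lemma jacobian_degree_gt0 : (0 < d)%N.
Proof.
rewrite lt0n; apply/eqP => d0; have [j /eqP] := eliminable_neq0 jacobian_eliminable; apply.
by rewrite /f -(homog_part_id Fhomog) d0 homog_part0E mderivC.
Qed.
End JacobianIdeal.

Section GenericSyzygy.
Variables (K : numClosedFieldType).
Local Notation R := {mpoly K[3]}.
Variables (f : 'I_3 -> R) (e : nat).
Hypothesis fhomog : forall i, f i \is e.-homog.
Hypothesis felim : eliminable f.
Variables (r s : nat) (a u : 'I_3 -> R) (eps : R).
Hypotheses (ahom : forall i, a i \is r.-homog) (uhom : forall i, u i \is s.-homog).
Hypotheses (rs : (r <= s)%N) (feps : forall i, f i = eps * cross a u i).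
Hypothesis au_zero : forall p : 'I_3 -> K, (exists k, p k != 0) ->
  (forall i, (f i).@[p] = 0) -> ~ (forall i, (a i).@[p] = 0 /\ (u i).@[p] = 0).

Lemma common_nonroot (I : finType) (q : I -> {poly K}) :
  exists x, forall i, q i != 0 -> (q i).[x] != 0.
Proof.
have : \prod_(i | q i != 0) q i != 0 by apply/prodf_neq0.
move/closed_nonrootP => [x]; rewrite /root horner_prod => /prodf_neq0 H.
by exists x.
Qed.

(** Away from the singular points the vectors [a] and [u] are independent, so
    [u + g a] vanishes at no other point, whatever [g]. At a singular point they
    are not both zero, so a suitable value of [g] makes [u + g a] nonzero; since
    there are finitely many singular points, [g] can be taken as a general
    multiple of a power of a general linear form. *)
Lemma generic_syzygy : exists w : 'I_3 -> R,
  [/\ forall i, w i \is s.-homog, exists g, forall i, w i = u i + g * a i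
    & forall p : 'I_3 -> K, (exists k, p k != 0) -> exists i, (w i).@[p] != 0].
Proof.
have [L HL] := finite_zero_ratios felim.
pose pt (phi : {ffun 'I_3 -> 'I_(size L)}) i := tnth (in_tuple L) (phi i).
pose q phi : {poly K} := (pt phi ix)%:P + pt phi iy *: 'X + pt phi iz *: 'X^2.
(* [l] is a linear form that vanishes at no candidate point; [q] is its value
   as a polynomial in the parameter [t] *)
have [t Ht] := common_nonroot q.
pose l : R := 'X_ix + t *: 'X_iy + t ^+ 2 *: 'X_iz.
have lE p : l.@[p] = p ix + t * p iy + t ^+ 2 * p iz.
  by rewrite !mevalD !mevalZ !mevalXU.
have l_pt phi i : pt phi i != 0 -> l.@[pt phi] != 0.
  move=> pti; have -> : l.@[pt phi] = (q phi).[t] 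
    by rewrite lE /q !hornerD !hornerZ hornerC hornerX hornerXn; ring.
  suff /Ht : q phi != 0 by [].
  apply: contra_neq pti => q0.
  have qc n : (q phi)`_n = 0 by rewrite q0 coef0.
  move: (qc 0%N) (qc 1%N) (qc 2); rewrite /q !coefD !coefZ !coefC !coefX !coefXn /=.
  rewrite !mulr0 !mulr1 !addr0 !add0r => c0 c1 c2.
  by elim/ord3_ind: i.
pose P (z : {ffun 'I_3 -> 'I_(size L)} * 'I_3) : {poly K} :=
  ((u z.2).@[pt z.1])%:P + (l.@[pt z.1] ^+ (s - r) * (a z.2).@[pt z.1]) *: 'X.
(* [P] is an entry of [u + c l^(s-r) a] at a candidate point, as a polynomial
   in [c] *)
have [c Hc] := common_nonroot P.
pose g : R := c%:MP * l ^+ (s - r).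
pose w i := u i + g * a i.
have lhom : l \is 1.-homog.
  by rewrite !rpredD ?rpredZ // dhomogX /= mdeg1.
have whom i : w i \is s.-homog.
  rewrite rpredD //= /g -mulrA mul_mpolyC rpredZ //.
  by have := dhomogM (dhomogMn (s - r) lhom) (ahom i); rewrite mul1n subnK.
have wE p i : (w i).@[p] = (u i).@[p] + c * l.@[p] ^+ (s - r) * (a i).@[p].
  by rewrite /w /g mevalD !mevalM mevalC rmorphXn.
exists w; split=> //; first by exists g.
move=> p [k pk]; apply: contrapT => /forallNP w0.
have {}w0 i : (w i).@[p] = 0 by apply/eqP; have /negP := w0 i; rewrite negbK.
have fp i : (f i).@[p] = 0.
  have -> : f i = eps * cross a w i.
    by rewrite feps /w; elim/ord3_ind: i; rewrite /cross /=; ring.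
  rewrite mevalM (_ : (cross a w i).@[p] = 0) ?mulr0 //.
  by elim/ord3_ind: i; rewrite /cross /= mevalB !mevalM !w0 !mulr0 subrr.
have Hphi j : exists x : 'I_(size L), tnth (in_tuple L) x = p j / p k.
  have /tnthP [x ->] : p j / p k \in in_tuple L by apply: HL.
  by exists x.
pose phi : {ffun 'I_3 -> 'I_(size L)} := [ffun j => projT1 (cid (Hphi j))].
have ptE j : pt phi j = (p k)^-1 * p j.
  by rewrite /pt ffunE (projT2 (cid (Hphi j))) mulrC.
have ptF : pt phi = fun j => (p k)^-1 * p j by apply: funext.
have ptk : pt phi k != 0 by rewrite ptE mulVf // oner_neq0.
apply: (au_zero (p := pt phi)); first by exists k.
  by move=> i; rewrite ptF (meval_homog _ _ (fhomog i)) fp mulr0.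
move=> i; have : P (phi, i) = 0.
  apply/eqP; apply: contraT => /Hc.
  rewrite /P /= hornerD hornerC hornerZ hornerX [X in _ + X](_ : _ = c * l.@[pt phi] ^+ (s - r) * (a i).@[pt phi]).
    by rewrite -wE ptF (meval_homog _ _ (whom i)) w0 mulr0 eqxx.
  by rewrite mulrC mulrA.
move=> P0; have Pc n : (P (phi, i))`_n = 0 by rewrite P0 coef0.
move: (Pc 0%N) (Pc 1%N); rewrite /P !coefD !coefZ !coefC !coefX /=.
rewrite mulr0 mulr1 addr0 add0r => -> /eqP.
by rewrite mulf_eq0 expf_eq0 (negbTE (l_pt _ _ ptk)) andbF /= => /eqP ->.
Qed.
End GenericSyzygy.

Theorem theorem2p2 (R : realType) (F : {mpoly R[i][3]})
    (Fhomog : homogeneous F)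
    (Fred : reduced_poly F)
    (Fheight : ideal_height (jacobian_ideal F) 2)
    (Fquasi : quasihomogeneous_curve F) :
  free_curve F <->
  exists A B C : {mpoly R[i][3]},
    [/\ homogeneous A /\ homogeneous B /\ homogeneous C,
        A * F^`M(ix) + B * F^`M(iy) + C * F^`M(iz) = 0
      & regular_sequence [:: A; B; C]].
Proof.
have [d Fd] := Fhomog; have [F0 _] := Fred.
have felim := jacobian_eliminable Fd Fheight.
have d_gt0 := jacobian_degree_gt0 Fd Fheight.
pose f i := F^`M(i).
have fhomog i : f i \is d.-1.-homog by apply: mderiv_homog.
split=> [Ffree|[A [B [C [_ ABC reg]]]]]; last first.
  pose w i := if i == ix then A else if i == iy then B else C.
  by apply: (regular_syzygy_free Fd d_gt0 F0 felim (w := w)); rewrite ?dotE.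
have [r [s [a [u [[ahom af] [uhom uf] rs [eps feps] span]]]]] :=
  homogeneous_basis Fd d_gt0 F0 felim Ffree.
have au_zero p : (exists k, p k != 0) -> (forall i, (f i).@[p] = 0) ->
    ~ (forall i, (a i).@[p] = 0 /\ (u i).@[p] = 0).
  move=> p0 fp au0; have sing : singular_point F p by split.
  have [v [vf [i vi]]] := quasihomogeneous_syzygy Fd d_gt0 felim sing (Fquasi _ sing).
  have [x [y Hv]] := span _ vf; have [ai ui] := au0 i.
  by move: vi; rewrite Hv mevalD !mevalM ai ui !mulr0 addr0 eqxx.
have [w [whom [g wE] w0]] := generic_syzygy fhomog felim ahom uhom rs feps au_zero.
have crossw i : cross a w i = cross a u i.
  by elim/ord3_ind: i; rewrite /cross /= !wE; ring.
have wf : dot w f = 0.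
  transitivity (dot u f + g * dot a f); last by rewrite uf af mulr0 addr0.
  by rewrite !dotE !wE; ring.
have welim : eliminable w.
  move=> k j /felim [n [q [q0 sq [c ec]]]]; exists n, q; split=> //.
  rewrite ec; apply: (big_ind (lincomb w)) => [|? ? ? ?|i _].
  - by exists (fun=> 0); rewrite big1 // => i _; rewrite mul0r.
  - exact: lincombD.
  apply: lincombMl; rewrite -/(f i) [f i]feps -crossw; apply: lincombMl.
  elim/ord3_ind: i.
  - by exists (fun t => if t == ix then 0 else if t == iy then - a iz else a iy);
      rewrite sum3 /cross /=; ring.
  - by exists (fun t => if t == ix then a iz else if t == iy then 0 else - a ix);
      rewrite sum3 /cross /=; ring.
  - by exists (fun t => if t == ix then - a iy else if t == iy then a ix else 0);
      rewrite sum3 /cross /=; ring.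
(* in degree zero [a x u] would be a nonzero constant in the Jacobian ideal *)
have s_gt0 : (0 < s)%N.
  rewrite lt0n; apply/eqP => s0; apply: (jacobian_proper Fheight).
  have r0 : r = 0%N by apply/eqP; rewrite -leqn0 -s0.
  have [t ft] := eliminable_neq0 felim.
  have [be Hbe] := orthogonal_cross felim uf af.
  have ct0 : cross a u t != 0 by apply: contra_neq ft => ct0; rewrite -/(f t) [f t]feps ct0 mulr0.
  have [c ec] : exists c, cross a u t = c%:MP.
    have const (v : {mpoly R[i][3]}) n : n = 0%N -> v \is n.-homog ->
        exists c : R[i], v = c%:MP.
      by move=> -> v0; exists v.@[fun=> 0]; rewrite -homog_part0E homog_part_id.
    have [c Hc] : exists c : 'I_3 -> R[i], forall i, a i = (c i)%:MP.
      have H i := cid (const _ _ r0 (ahom i)).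
      by exists (fun i => projT1 (H i)) => i; apply: (projT2 (H i)).
    have [c' Hc'] : exists c : 'I_3 -> R[i], forall i, u i = (c i)%:MP.
      have H i := cid (const _ _ s0 (uhom i)).
      by exists (fun i => projT1 (H i)) => i; apply: (projT2 (H i)).
    exists (cross c c' t).
    by elim/ord3_ind: (t); rewrite /cross /= !Hc !Hc' mpolyCB !mpolyCM.
  have c0 : c != 0 by apply: contra_neq ct0 => c0; rewrite ec c0 mpolyC0.
  have -> : 1 = (c^-1)%:MP * be * f t.
    by rewrite -mulrA -Hbe ec -mpolyCM mulVf // mpolyC1.
  apply: lincombMl; exists (fun i => (i == t)%:R).
  by rewrite (bigD1 t) //= eqxx mul1r big1 ?addr0 // => i /negbTE ->; rewrite mul0r.
exists (w ix), (w iy), (w iz); split.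
- by split; [|split]; exists s.
- by have := wf; rewrite dotE.
- exact: nozero_regular welim w0 s_gt0.
Qed.
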